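(* Assume $\operatorname{char}(\Bbbk)\neq 2$. Let $B\subseteq A$ and $D\subseteq C$ be extensions of $\Bbbk$-algebras, and let $M\in A\text{-mod}$, $X\in A^{\mathrm{op}}\text{-mod}$, $N\in C\text{-mod}$ and $Y\in C^{\mathrm{op}}\text{-mod}$. Then, for every $n\ge 0$, $$\operatorname{Tor}^{(A\otimes C,\,B\otimes D)}_{n}(X\otimes Y,\,M\otimes N)\;\cong\;\bigoplus_{s+r=n}\operatorname{Tor}^{(A,B)}_{s}(X,M)\otimes\operatorname{Tor}^{(C,D)}_{r}(Y,N).$$
   Context: Throughout, $\Bbbk$ is a perfect field and all algebras are Artin algebras over $\Bbbk$ (finite-dimensional, associative, unital); $\otimes=\otimes_\Bbbk$. An extension $B\subseteq A$ is an algebra $A$ with a unital subalgebra $B$. $A\text{-mod}$ is the category of finitely generated left $A$-modules; right $A$-modules are identified with left $A^{\mathrm{op}}$-modules. A module $M\in A\text{-mod}$ is $(A,B)$-projective if the multiplication map $A\otimes_B M\to M$ is a split epimorphism of $A$-modules. An $(A,B)$-exact sequence is a complex of $A$-modules $(M_n,d_n)$ admitting a $B$-homotopy, i.e. $B$-linear maps $h_n:M_n\to M_{n+1}$ with $d_{n+1}h_n+h_{n-1}d_n=1_{M_n}$ for all $n$. An $(A,B)$-projective resolution of $M$ is an $(A,B)$-exact sequence $\cdots\to P_1\to P_0\to M\to 0$ with all $P_i$ being $(A,B)$-projective; its deleted version is $P_\bullet$ (with $M$ replaced by $0$). For $X\in A^{\mathrm{op}}\text{-mod}$, $\operatorname{Tor}^{(A,B)}_n(X,M)=H_n(X\otimes_A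 P_\bullet)$. *)

(* Defs.v *)
From HB Require Import structures.
From mathcomp Require Import all_boot all_algebra falgebra separable.

Set Implicit Arguments.
Unset Strict Implicit.
Unset Printing Implicit Defensive.

Import GRing.Theory VectorInternalTheory.
Local Open Scope ring_scope.

Definition perfect_field (K : fieldType) : Prop :=
  forall p : {poly K}, irreducible_poly p -> separable_poly p.

Definition isomorphic (K : fieldType) (U V : vectType K) : Prop :=
  exists f : 'Hom(U, V), bijective f.

(* F 0 (+) F 1 (+) ... (+) F n *)
Fixpoint dsum (K : fieldType) (F : nat -> vectType K) (n : nat) : vectType K :=
  if n is m.+1 then (dsum F m * F m.+1)%type : vectType K else F 0%N.

Section Quotient.

Variables (K : fieldType) (V : vectType K).
Implicit Types Z W : {vspace V}.

(* The quotient Z / (Z :&: W), carried by a complement of Z :&: W in Z and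
   equipped with its projection qproj; see qproj_onto and qproj_eq0. *)
Definition quotv Z W : vectType K := subvs_of (Z :\: W)%VS.

Definition qproj Z W : 'Hom(V, quotv Z W) :=
  linfun (vsproj (Z :\: W)%VS \o addv_pi1 Z W).

Definition qsec Z W : 'Hom(quotv Z W, V) := linfun vsval.

Lemma qsec_mem Z W q : qsec Z W q \in Z.
Proof. by rewrite lfunE; apply: subvP (diffvSl Z W) _ (subvsP q). Qed.

Lemma qsecK Z W : cancel (qsec Z W) (qproj Z W).
Proof.
move=> q; rewrite /qproj !lfunE /=.
by rewrite [addv_pi1 Z W _]daddv_pi_id ?capv_diff ?subvsP ?vsvalK.
Qed.

Lemma qproj_onto Z W : (qproj Z W @: Z = fullv)%VS.
Proof.
apply/eqP; rewrite eqEsubv subvf; apply/subvP=> q _.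
by rewrite -[q]qsecK memv_img ?qsec_mem.
Qed.

Lemma qsec_qproj Z W v : v \in (Z + W)%VS -> v - qsec Z W (qproj Z W v) \in W.
Proof.
move=> Zv; have Dv := addv_pi1_pi2 Zv.
rewrite /qproj /qsec !lfunE /= vsprojK; last exact: memv_pi.
by rewrite -{1}Dv addrC addKr memv_pi2.
Qed.

Lemma qproj_eq0 Z W v : v \in Z -> (qproj Z W v == 0) = (v \in W).
Proof.
move=> Zv; have ZWv: v \in (Z + W)%VS by apply: subvP (addvSl Z W) _ Zv.
apply/eqP/idP=> [q0 | Wv].
  by have := qsec_qproj ZWv; rewrite q0 linear0 subr0.
apply: (@subvs_inj _ _ _ _ _); rewrite linear0 lfunE /=.
rewrite vsprojK; last exact: memv_pi.
have := addv_pi1_pi2 ZWv; rewrite (addv_pi2_id _ Wv).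
by move/(canRL (addrK _)); rewrite subrr.
Qed.

End Quotient.

(* V1 / W1 -> V2 / W2 induced by f; meaningful when f maps W1 into W2. *)
Definition qmap (K : fieldType) (V1 V2 : vectType K) (W1 : {vspace V1})
    (W2 : {vspace V2}) (f : 'Hom(V1, V2)) :
    'Hom(quotv fullv W1, quotv fullv W2) :=
  linfun (qproj fullv W2 \o f \o qsec fullv W1).

Lemma qmapE (K : fieldType) (V1 V2 : vectType K) (W1 : {vspace V1})
    (W2 : {vspace V2}) (f : 'Hom(V1, V2)) (v : V1) :
  (f @: W1 <= W2)%VS -> qmap W1 W2 f (qproj fullv W1 v) = qproj fullv W2 (f v).
Proof.
move=> fW; rewrite lfunE /=; apply/eqP; rewrite eq_sym -subr_eq0.
rewrite -!linearB qproj_eq0 ?memvf //; apply: (subvP fW); apply: memv_img.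
by apply: qsec_qproj; apply: subvP (addvSl _ _) _ (memvf _).
Qed.

Section Bilinear.

Variables (K : fieldType) (U V W : vectType K) (f : U -> V -> W).

Definition bilin : Prop := (forall u, linear (f u)) /\ (forall v, linear (f^~ v)).

Hypothesis fB : bilin.

Let fl v : {linear U -> W} :=
  HB.pack (f^~ v) (GRing.isLinear.Build K U W _ (f^~ v) (proj2 fB v)).
Let fr u : {linear V -> W} :=
  HB.pack (f u) (GRing.isLinear.Build K V W _ (f u) (proj1 fB u)).

Lemma bilinZl a u v : f (a *: u) v = a *: f u v.
Proof. exact: (linearZ_LR (fl v)). Qed.

Lemma bilinZr a u v : f u (a *: v) = a *: f u v.
Proof. exact: (linearZ_LR (fr u)). Qed.

Lemma bilin_suml (I : finType) (F : I -> U) v : f (\sum_i F i) v = \sum_i f (F i) v.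
Proof. exact: (linear_sum (fl v)). Qed.

Lemma bilin_sumr (I : finType) u (F : I -> V) : f u (\sum_i F i) = \sum_i f u (F i).
Proof. exact: (linear_sum (fr u)). Qed.

End Bilinear.

(* U (x) V in coordinates: u (x) v is the outer product of the coordinate
   vectors of u and v.  The universal property is tliftE and eq_tens. *)
Definition tens (K : fieldType) (U V : vectType K) : Type :=
  'M[K]_(dim U, dim V).

HB.instance Definition _ (K : fieldType) (U V : vectType K) :=
  Vector.copy (tens U V) 'M[K]_(dim U, dim V).

Section Tensor.

Variable K : fieldType.
Implicit Types U V W : vectType K.

Definition pure U V (u : U) (v : V) : tens U V := (v2r u)^T *m v2r v.

Local Notation "u ⊗ v" := (pure u v) (at level 40, left associativity).

Lemma pure_bilin U V : bilin (@pure U V).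
Proof.
split=> [u | v] a x y; rewrite /pure.
  by rewrite linearP mulmxDr -scalemxAr.
by rewrite !linearP /= mulmxDl -scalemxAl.
Qed.

Definition vbase U (i : 'I_(dim U)) : U := r2v (delta_mx 0 i).

Lemma vbaseE U (u : U) : u = \sum_i v2r u 0 i *: vbase i.
Proof.
apply: v2r_inj; rewrite [LHS]row_sum_delta linear_sum /=.
by apply: eq_bigr => i _; rewrite linearZ /= r2vK.
Qed.

Lemma tensE U V (t : tens U V) : t = \sum_i \sum_j t i j *: (vbase i ⊗ vbase j).
Proof.
rewrite [LHS]matrix_sum_delta; apply: eq_bigr => i _; apply: eq_bigr => j _.
by rewrite /pure /vbase !r2vK trmx_delta mul_delta_mx.
Qed.

Lemma eq_tens U V W (f g : 'Hom(tens U V, W)) :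
  (forall u v, f (u ⊗ v) = g (u ⊗ v)) -> f = g.
Proof.
move=> fg; apply/lfunP=> t; rewrite [t]tensE !linear_sum; apply: eq_bigr => i _.
by rewrite !linear_sum; apply: eq_bigr => j _; rewrite !linearZ /= fg.
Qed.


Lemma tens_ind U V (P : tens U V -> Prop) :
    P 0 -> (forall s t, P s -> P t -> P (s + t)) -> (forall u v, P (u ⊗ v)) ->
  forall t, P t.
Proof.
move=> P0 PD Pp t; rewrite [t]tensE; elim/big_ind: _ => // i _.
by elim/big_ind: _ => // j _; rewrite -bilinZl //; apply: pure_bilin.
Qed.

Definition tlift_fun U V W (f : U -> V -> W) (t : tens U V) : W :=
  \sum_i \sum_j t i j *: f (vbase i) (vbase j).

Fact tlift_fun_linear U V W (f : U -> V -> W) : linear (tlift_fun f).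
Proof.
move=> a s t; rewrite /tlift_fun scaler_sumr -big_split; apply: eq_bigr => i _.
rewrite scaler_sumr -big_split; apply: eq_bigr => j _.
by rewrite !mxE scalerDl scalerA.
Qed.

HB.instance Definition _ U V W (f : U -> V -> W) :=
  GRing.isLinear.Build K (tens U V) W _ (tlift_fun f) (tlift_fun_linear f).

Definition tlift U V W (f : U -> V -> W) : 'Hom(tens U V, W) :=
  linfun (tlift_fun f).

Lemma tliftE U V W (f : U -> V -> W) u v :
  bilin f -> tlift f (u ⊗ v) = f u v.
Proof.
move=> fB; rewrite lfunE /= /tlift_fun {2}[u]vbaseE bilin_suml //.
apply: eq_bigr => i _; rewrite bilinZl // {2}[v]vbaseE bilin_sumr // scaler_sumr.
apply: eq_bigr => j _.
by rewrite bilinZr // scalerA /pure mxE big_ord1 mxE.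
Qed.

Definition tmap U V U' V' (f : 'Hom(U, U')) (g : 'Hom(V, V')) :
    'Hom(tens U V, tens U' V') :=
  tlift (fun u v => f u ⊗ g v).

Lemma tmapE U V U' V' (f : 'Hom(U, U')) (g : 'Hom(V, V')) u v :
  tmap f g (u ⊗ v) = f u ⊗ g v.
Proof.
rewrite /tmap tliftE //; have [pr pl] := pure_bilin U' V'.
split=> [w | w] a x y; rewrite linearP.
  exact: pr.
exact: (pl (g w)).
Qed.

Lemma tmap_comp U V U' V' U2 V2 (f : 'Hom(U, U')) (g : 'Hom(V, V'))
    (f' : 'Hom(U', U2)) (g' : 'Hom(V', V2)) :
  (tmap f' g' \o tmap f g)%VF = tmap (f' \o f)%VF (g' \o g)%VF.
Proof. by apply: eq_tens => u v; rewrite comp_lfunE !tmapE !comp_lfunE. Qed.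

Lemma tmap1 U V : tmap \1%VF \1%VF = \1%VF :> 'End(tens U V).
Proof. by apply: eq_tens => u v; rewrite tmapE !id_lfunE. Qed.

Lemma tmap_bilin U V U' V' : bilin (@tmap U V U' V').
Proof.
have [pr pl] := pure_bilin U' V'.
split=> [f | f] a x y; apply: eq_tens => u v;
  rewrite add_lfunE scale_lfunE !tmapE add_lfunE scale_lfunE.
  exact: pr.
exact: (pl (f v)).
Qed.

(* The span of the products u (x) v with u in S and v in T. *)
Definition tensv U V (S : {vspace U}) (T : {vspace V}) : {vspace tens U V} :=
  <<[seq u ⊗ v | u <- vbasis S, v <- vbasis T]>>%VS.

Lemma memv_tens U V (S : {vspace U}) (T : {vspace V}) u v :
  u \in S -> v \in T -> u ⊗ v \in tensv S T.
Proof.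
have pB := pure_bilin U V.
move=> /coord_vbasis-> /coord_vbasis->.
rewrite bilin_suml // rpred_sum // => i _.
rewrite bilinZl // rpredZ // bilin_sumr // rpred_sum // => j _.
rewrite bilinZr // rpredZ // memv_span //.
by apply: allpairs_f; rewrite mem_nth ?size_tuple.
Qed.

Lemma tensv_sub U V (S : {vspace U}) (T : {vspace V}) (W : {vspace tens U V}) :
  (forall u v, u \in S -> v \in T -> u ⊗ v \in W) -> (tensv S T <= W)%VS.
Proof.
move=> STW; apply/span_subvP=> _ /allpairsP[[u v] /= [uS vT ->]].
by apply: STW; apply: vbasis_mem.
Qed.

Lemma pure_eq0 U V (u : U) (v : V) : (u ⊗ v == 0) = (u == 0) || (v == 0).
Proof.
apply/eqP/idP=> [uv0 | /orP[] /eqP->]; last 2 first.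
- by rewrite /pure linear0 trmx0 mul0mx.
- by rewrite /pure linear0 mulmx0.
apply: contraT; rewrite negb_or => /andP[u0 v0].
have /rV0Pn[i ui]: v2r u != 0 by rewrite -(inj_eq (@r2v_inj _ _)) v2rK linear0.
have /rV0Pn[j vj]: v2r v != 0 by rewrite -(inj_eq (@r2v_inj _ _)) v2rK linear0.
move/matrixP/(_ i j): uv0; rewrite !mxE big_ord1 mxE => /eqP.
by rewrite mulf_eq0 (negPf ui) (negPf vj).
Qed.

End Tensor.

Notation "u ⊗ v" := (pure u v) (at level 40, left associativity) : ring_scope.

Section TensorAlgebra.

Variables (K : fieldType) (A C : falgType K).

(* t |-> (t' |-> t * t'), where (a ⊗ c) * (a' ⊗ c') = (a * a') ⊗ (c * c') *)
Definition tens_amull : 'Hom(tens A C, 'End(tens A C)) :=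
  tlift (fun a c => tmap (amull a) (amull c)).

Definition tens_mul (s t : tens A C) : tens A C := tens_amull s t.

Fact tens_mul_bilin : bilin tens_mul.
Proof.
split=> [s|t] a x y; rewrite /tens_mul linearP //.
by rewrite add_lfunE scale_lfunE.
Qed.

Fact tens_mulE (a a' : A) (c c' : C) :
  tens_mul (a ⊗ c) (a' ⊗ c') = (a * a') ⊗ (c * c').
Proof.
rewrite /tens_mul tliftE ?tmapE ?lfunE //; have [tr tl] := @tmap_bilin K A C A C.
split=> [u|u] k x y; rewrite linearP; first exact: tr.
exact: (tl (amull u)).
Qed.

Fact tens_mulDl : left_distributive tens_mul +%R.
Proof. by move=> s t x; rewrite /tens_mul linearD add_lfunE. Qed.

Fact tens_mulDr : right_distributive tens_mul +%R.
Proof. by move=> s t x; rewrite /tens_mul linearD. Qed.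

Fact tens_mul0l t : tens_mul 0 t = 0.
Proof. by rewrite /tens_mul linear0 zero_lfunE. Qed.

Fact tens_mul0r t : tens_mul t 0 = 0.
Proof. by rewrite /tens_mul linear0. Qed.

Fact tens_mulA : associative tens_mul.
Proof.
elim/tens_ind=> [|s s' IHs IHs'|a c] t x; first by rewrite !tens_mul0l.
  by rewrite !tens_mulDl IHs IHs'.
elim/tens_ind: t => [|t t' IHt IHt'|a' c'].
- by rewrite tens_mul0l !tens_mul0r tens_mul0l.
- by rewrite tens_mulDl !tens_mulDr tens_mulDl IHt IHt'.
elim/tens_ind: x => [|x x' IHx IHx'|a2 c2]; first by rewrite !tens_mul0r.
  by rewrite !tens_mulDr IHx IHx'.
by rewrite !tens_mulE !mulrA.
Qed.

Fact tens_mul1l : left_id (1 ⊗ 1) tens_mul.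
Proof.
elim/tens_ind=> [|s t IHs IHt|a c]; first exact: tens_mul0r.
  by rewrite tens_mulDr IHs IHt.
by rewrite tens_mulE !mul1r.
Qed.

Fact tens_mul1r : right_id (1 ⊗ 1) tens_mul.
Proof.
elim/tens_ind=> [|s t IHs IHt|a c]; first exact: tens_mul0l.
  by rewrite tens_mulDl IHs IHt.
by rewrite tens_mulE !mulr1.
Qed.

Fact tens_one_neq0 : 1 ⊗ 1 != 0 :> tens A C.
Proof. by rewrite pure_eq0 !oner_eq0. Qed.

HB.instance Definition _ := GRing.Zmodule_isNzRing.Build (tens A C)
  tens_mulA tens_mul1l tens_mul1r tens_mulDl tens_mulDr tens_one_neq0.

Fact tens_scaleAl (k : K) (s t : tens A C) : k *: (s * t) = (k *: s) * t.
Proof. exact: esym (bilinZl tens_mul_bilin _ _ _). Qed.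

HB.instance Definition _ :=
  GRing.Lmodule_isLalgebra.Build K (tens A C) tens_scaleAl.

Fact tens_scaleAr (k : K) (s t : tens A C) : k *: (s * t) = s * (k *: t).
Proof. exact: esym (bilinZr tens_mul_bilin _ _ _). Qed.

HB.instance Definition _ :=
  GRing.Lalgebra_isAlgebra.Build K (tens A C) tens_scaleAr.

HB.instance Definition _ := Algebra_isFalgebra.Build K (tens A C).

Lemma pureM (a a' : A) (c c' : C) : (a ⊗ c) * (a' ⊗ c') = (a * a') ⊗ (c * c').
Proof. exact: tens_mulE. Qed.

Fact tensv_is_aspace (B : {aspace A}) (D : {aspace C}) : is_aspace (tensv B D).
Proof.
apply/andP; split.
  apply/has_algidP; exists (algid B ⊗ algid D); split.
  - by rewrite memv_tens ?memv_algid.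
  - by rewrite pure_eq0 negb_or !algid_neq0.
  move=> t tBD; have: t \in lker (amull (algid B ⊗ algid D) - \1%VF).
    apply: subvP tBD; apply: tensv_sub => u v uB vD.
    by rewrite memv_ker !lfun_simp /= pureM !algidl ?subrr.
  have: t \in lker (amulr (algid B ⊗ algid D) - \1%VF).
    apply: subvP tBD; apply: tensv_sub => u v uB vD.
    by rewrite memv_ker !lfun_simp /= pureM !algidr ?subrr.
  by rewrite !memv_ker !lfun_simp /= !subr_eq0 => /eqP-> /eqP->.
apply/prodvP=> s t sBD tBD.
suffices: s \in (amulr t @^-1: tensv B D)%VS by rewrite -memv_preim lfunE.
apply: subvP sBD; apply: tensv_sub => u v uB vD; rewrite -memv_preim lfunE /=.
suffices: t \in (amull (u ⊗ v) @^-1: tensv B D)%VS by rewrite -memv_preim lfunE.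
apply: subvP tBD; apply: tensv_sub => u' v' u'B v'D; rewrite -memv_preim lfunE /=.
by rewrite pureM memv_tens ?memvM.
Qed.

Lemma tensv1 (B : {aspace A}) (D : {aspace C}) :
  1 \in B -> 1 \in D -> 1 \in tensv B D.
Proof. exact: memv_tens. Qed.

Canonical tensv_aspace (B : {aspace A}) (D : {aspace C}) :=
  ASpace (tensv_is_aspace B D).

End TensorAlgebra.

(* Left (resp. right) modules.  As A is finite-dimensional over K, a module is
   finitely generated iff it is finite-dimensional over K, so the carrier is a
   vectType K and the action is a K-linear (anti-)representation of A. *)
Record lmodule (K : fieldType) (A : falgType K) := LModule {
  lcar :> vectType K;
  lact : 'Hom(A, 'End(lcar));
  _ : lact 1 = \1%VF;
  _ : forall a b, lact (a * b) = (lact a \o lact b)%VF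
}.

Record rmodule (K : fieldType) (A : falgType K) := RModule {
  rcar :> vectType K;
  ract : 'Hom(A, 'End(rcar));
  _ : ract 1 = \1%VF;
  _ : forall a b, ract (a * b) = (ract b \o ract a)%VF
}.

Arguments lact {K A} _.
Arguments ract {K A} _.

Section Modules.

Variables (K : fieldType) (A : falgType K).
Implicit Types (M N : lmodule A) (X : rmodule A) (S : {vspace A}).

Lemma lact1 M : lact M 1 = \1%VF. Proof. by case: M. Qed.
Lemma lactM M a b : lact M (a * b) = (lact M a \o lact M b)%VF.
Proof. by case: M. Qed.
Lemma ract1 X : ract X 1 = \1%VF. Proof. by case: X. Qed.
Lemma ractM X a b : ract X (a * b) = (ract X b \o ract X a)%VF.
Proof. by case: X. Qed.

(* f is S-linear; A-linear maps are those with S = {:A}. *)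
Definition act_linear S M N (f : 'Hom(M, N)) : Prop :=
  forall a, a \in S -> forall m, f (lact M a m) = lact N a (f m).

Fact rregE a x : linfun (@amulr K A) a x = x * a.
Proof.
have -> : linfun (@amulr K A) a = amulr a by exact: lfunE.
by rewrite lfunE.
Qed.

Fact rreg_ract1 : linfun (@amulr K A) 1 = \1%VF.
Proof. by apply/lfunP=> a; rewrite rregE id_lfunE mulr1. Qed.

Fact rreg_ractM a b :
  linfun (@amulr K A) (a * b) =
  (linfun (@amulr K A) b \o linfun (@amulr K A) a)%VF.
Proof. by apply/lfunP=> x; rewrite comp_lfunE !rregE mulrA. Qed.

(* A as a right A-module *)
Definition rreg : rmodule A := RModule rreg_ract1 rreg_ractM.

(* x ⊗ m |-> x b ⊗ m - x ⊗ b m *)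
Definition bal X M (b : A) : 'End(tens X M) :=
  tmap (ract X b) \1 - tmap \1 (lact M b).

(* The subspace of X ⊗ M spanned by all x b ⊗ m - x ⊗ b m with b in S. *)
Definition balv S X M : {vspace tens X M} :=
  (\sum_(i < \dim S) limg (bal X M (vbasis S)`_i))%VS.

Lemma balE X M b x m : bal X M b (x ⊗ m) = ract X b x ⊗ m - x ⊗ lact M b m.
Proof. by rewrite /bal add_lfunE opp_lfunE !tmapE !id_lfunE. Qed.

Fact bal_bilin X M : bilin (bal X M).
Proof.
split=> [b|t] k; first by move=> s t; rewrite linearP.
move=> b c; rewrite -scale_lfunE -add_lfunE; congr (fun_of_lfun _ _).
have [pr pl] := pure_bilin X M.
apply: eq_tens => x m; rewrite [RHS]add_lfunE [X in _ = X + _]scale_lfunE !balE.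
rewrite !linearP !add_lfunE !scale_lfunE (pl m) (pr x) scalerBr opprD.
by rewrite addrACA.
Qed.

Lemma balv_mem S X M b t : b \in S -> bal X M b t \in balv S X M.
Proof.
have bB := bal_bilin X M.
move=> /coord_vbasis->; rewrite (bilin_suml bB); apply: rpred_sum => i _.
rewrite (bilinZl bB); apply: rpredZ.
by rewrite memvE (sumv_sup i) // -memvE memv_img ?memvf.
Qed.

Lemma balv_sub S X M (W : {vspace tens X M}) :
    (forall b x m, b \in S -> ract X b x ⊗ m - x ⊗ lact M b m \in W) ->
  (balv S X M <= W)%VS.
Proof.
move=> SW; apply/subv_sumP=> i _; apply/subvP=> _ /memv_imgP[t _ ->].
have biS: (vbasis S)`_i \in S by rewrite vbasis_mem ?mem_nth ?size_tuple.
elim/tens_ind: t => [|s t IHs IHt|x m]; first by rewrite linear0 mem0v.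
  by rewrite linearD rpredD.
by rewrite balE SW.
Qed.

(* X ⊗_S M *)
Definition otens S X M : vectType K := quotv fullv (balv S X M).

Definition opure S X M (x : X) (m : M) : otens S X M :=
  qproj fullv (balv S X M) (x ⊗ m).

(* 1_X ⊗_S f, for an S-linear f *)
Definition omap S X M N (f : 'Hom(M, N)) :
    'Hom(otens S X M, otens S X N) :=
  qmap (balv S X M) (balv S X N) (tmap \1 f).

Lemma omapE S X M N (f : 'Hom(M, N)) x m :
  act_linear S f -> omap S X f (opure S x m) = opure S x (f m).
Proof.
move=> fS; rewrite /omap /opure qmapE ?tmapE ?id_lfunE //.
apply/subvP=> _ /memv_imgP[t tB ->]; rewrite memv_preim; apply: subvP tB.
apply: balv_sub => b y n bS; rewrite -memv_preim linearB /= !tmapE !id_lfunE fS //.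
by rewrite -balE balv_mem.
Qed.

Lemma opure_bilin S X M : bilin (@opure S X M).
Proof.
have [pr pl] := pure_bilin X M; rewrite /opure.
by split=> [x|m] a u v /=; rewrite ?pr ?(pl m) linearP.
Qed.

Lemma opureA S X M b x m :
  b \in S -> opure S (ract X b x) m = opure S x (lact M b m).
Proof.
move=> bS; apply/eqP; rewrite -subr_eq0 -linearB qproj_eq0 ?memvf //.
by rewrite -balE balv_mem.
Qed.

Lemma eq_otens S X M (W : vectType K) (f g : 'Hom(otens S X M, W)) :
  (forall x m, f (opure S x m) = g (opure S x m)) -> f = g.
Proof.
move=> fg; pose p := qproj fullv (balv S X M).
have fgp: (f \o p = g \o p)%VF.
  by apply: eq_tens => x m; rewrite !comp_lfunE; apply: fg.
apply/lfunP=> q; rewrite -[q]qsecK.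
by have /lfunP/(_ (qsec _ _ q)) := fgp; rewrite !comp_lfunE.
Qed.

End Modules.

Section RelativeProjective.

Variables (K : fieldType) (A : falgType K).
Implicit Types (B : {vspace A}) (M N : lmodule A).

(* A ⊗_B M with the left A-action a (a' ⊗ m) = a a' ⊗ m *)
Definition ind_act B M (a : A) : 'End(otens B (rreg A) M) :=
  qmap (balv B (rreg A) M) (balv B (rreg A) M) (tmap (amull a) \1).

Lemma ind_actE B M a (a' : rreg A) m :
  ind_act B M a (opure B a' m) = opure B (a * a' : rreg A) m.
Proof.
rewrite /ind_act /opure qmapE ?tmapE ?id_lfunE ?lfunE //.
apply/subvP=> _ /memv_imgP[t tB ->]; rewrite memv_preim; apply: subvP tB.
apply: balv_sub => b y n bS; rewrite -memv_preim linearB /= !tmapE !id_lfunE.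
have := balv_mem ((a * y : rreg A) ⊗ n) bS.
by rewrite balE !rregE /= !lfunE /= mulrA.
Qed.

Fact ind_act_linear B M : linear (ind_act B M).
Proof.
have [_ ol] := opure_bilin B (rreg A) M.
move=> k a b; apply: eq_otens => x m; rewrite add_lfunE scale_lfunE !ind_actE.
by rewrite mulrDl -scalerAl; apply: (ol m).
Qed.

HB.instance Definition _ B M :=
  GRing.isLinear.Build K A _ _ (ind_act B M) (@ind_act_linear B M).

Fact ind_lact1 B M : linfun (ind_act B M) 1 = \1%VF.
Proof.
by apply: eq_otens => x m; rewrite lfunE /= ind_actE id_lfunE mul1r.
Qed.

Fact ind_lactM B M a b : linfun (ind_act B M) (a * b) =
  (linfun (ind_act B M) a \o linfun (ind_act B M) b)%VF.
Proof.
apply: eq_otens => x m.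
by rewrite comp_lfunE !(lfunE (ind_act B M)) /= !ind_actE mulrA.
Qed.

Definition ind B M : lmodule A := LModule (@ind_lact1 B M) (@ind_lactM B M).

(* The multiplication map A ⊗_B M -> M, a ⊗ m |-> a m *)
Definition mulmap B M : 'Hom(ind B M, M) :=
  linfun (tlift (fun (a : rreg A) (m : M) => lact M a m) \o qsec fullv _).

Lemma mulmapE B M (a : rreg A) m : mulmap B M (opure B a m) = lact M a m.
Proof.
pose mu := tlift (fun (a : rreg A) (m : M) => lact M a m).
have muE (c : rreg A) n : mu (c ⊗ n) = lact M c n.
  by rewrite tliftE //; split=> [u|u] k v w; rewrite linearP // add_lfunE scale_lfunE.
have muB: (balv B (rreg A) M <= lker mu)%VS.
  apply: balv_sub => b x n bB; rewrite memv_ker linearB /= !muE rregE.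
  by rewrite lactM comp_lfunE subrr.
rewrite /mulmap lfunE /= -/mu -muE; apply/eqP; rewrite eq_sym -subr_eq0 -linearB.
rewrite -memv_ker; apply: (subvP muB); apply: qsec_qproj.
by apply: subvP (addvSl _ _) _ (memvf _).
Qed.

Definition rel_projective B M : Prop :=
  exists2 s : 'Hom(M, ind B M), act_linear fullv s & (mulmap B M \o s)%VF = \1%VF.

(* ... -> obj 2 -> obj 1 -> obj 0 -> 0 *)
Record complex := Complex {
  obj :> nat -> lmodule A;
  diff : forall n, 'Hom(obj n.+1, obj n);
  _ : forall n, act_linear fullv (diff n);
  _ : forall n, (diff n \o diff n.+1)%VF = 0
}.

Lemma diff_linear (P : complex) n : act_linear fullv (diff P n).
Proof. by case: P. Qed.

Lemma diff_comp (P : complex) n : (diff P n \o diff P n.+1)%VF = 0.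
Proof. by case: P. Qed.

(* A B-homotopy contracting ... -> P 1 -> P 0 -> 0; the zero modules in negative
   degrees contribute nothing in degree 0. *)
Definition rel_exact B (P : complex) : Prop :=
  exists h : forall n, 'Hom(P n, P n.+1),
    [/\ forall n, act_linear B (h n), (diff P 0 \o h 0%N)%VF = \1%VF &
     forall n, ((diff P n.+1 \o h n.+1) + (h n \o diff P n))%VF = \1%VF].

Section Augment.

Variables (P : complex) (M : lmodule A) (e : 'Hom(P 0%N, M)).
Hypotheses (eL : act_linear fullv e) (e0 : (e \o diff P 0)%VF = 0).

Definition aug_obj n : lmodule A := if n is m.+1 then P m else M.

Definition aug_diff n : 'Hom(aug_obj n.+1, aug_obj n) :=
  if n is m.+1 return 'Hom(aug_obj n.+1, aug_obj n) then diff P m else e.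

Fact aug_linear n : act_linear fullv (aug_diff n).
Proof. by case: n => [|n] //=; apply: diff_linear. Qed.

Fact aug_comp n : (aug_diff n \o aug_diff n.+1)%VF = 0.
Proof. by case: n => [|n] //=; apply: diff_comp. Qed.

(* ... -> P 1 -> P 0 -> M -> 0 *)
Definition augment : complex := Complex aug_linear aug_comp.

End Augment.

Record rel_resolution B M := RelResolution {
  res :> complex;
  aug : 'Hom(res 0%N, M);
  aug_lin : act_linear fullv aug;
  aug_diff0 : (aug \o diff res 0)%VF = 0;
  res_proj : forall n, rel_projective B (res n);
  res_exact : rel_exact B (augment aug_lin aug_diff0)
}.

End RelativeProjective.

Section BarResolution.

Variables (K : fieldType) (A : falgType K) (B : {vspace A}).
Implicit Types M N : lmodule A.

Lemma ind_lactE M a (a' : rreg A) m :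
  lact (ind B M) a (opure B a' m) = opure B (a * a' : rreg A) m.
Proof. by rewrite /= (lfunE (ind_act B M)) /= ind_actE. Qed.

Definition ind_unit M : 'Hom(M, ind B M) :=
  linfun (fun m => opure B (1 : rreg A) m).

Fact ind_unit_linear M : linear (fun m => opure B (1 : rreg A) m : ind B M).
Proof. exact: (proj1 (opure_bilin B (rreg A) M)). Qed.

Lemma ind_unitE M m : ind_unit M m = opure B (1 : rreg A) m.
Proof.
pose L : {linear M -> ind B M} := HB.pack (fun m => opure B (1 : rreg A) m)
  (GRing.isLinear.Build K M (ind B M) _ _ (@ind_unit_linear M)).
exact: (lfunE L).
Qed.

Lemma ind_unit_act M : act_linear B (ind_unit M).
Proof.
move=> b bB m; rewrite !ind_unitE ind_lactE mulr1 -opureA // rregE.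
by rewrite mul1r.
Qed.

Lemma mulmap_act M : act_linear fullv (mulmap B M).
Proof.
move=> a _ m.
suff /lfunP/(_ m) : (mulmap B M \o lact (ind B M) a = lact M a \o mulmap B M)%VF.
  by rewrite (comp_lfunE (mulmap B M)) (comp_lfunE (lact M a)).
apply: eq_otens => x n; rewrite (comp_lfunE (mulmap B M)) (comp_lfunE (lact M a)).
by rewrite ind_lactE !mulmapE lactM comp_lfunE.
Qed.

Lemma mulmap_unit M : (mulmap B M \o ind_unit M)%VF = \1%VF.
Proof.
by apply/lfunP=> m; rewrite comp_lfunE ind_unitE mulmapE lact1.
Qed.

Lemma ind_projective M : rel_projective B (ind B M).
Proof.
have sE (x : rreg A) m :
    omap B (rreg A) (ind_unit M) (opure B x m) = opure B x (ind_unit M m).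
  by rewrite omapE //; apply: ind_unit_act.
pose s : 'Hom(ind B M, ind B (ind B M)) := omap B (rreg A) (ind_unit M).
exists s.
  move=> a _ m.
  suff /lfunP/(_ m) : (s \o lact (ind B M) a = lact (ind B (ind B M)) a \o s)%VF.
    by rewrite (comp_lfunE s) (comp_lfunE (lact _ a)).
  apply: eq_otens => x n; rewrite (comp_lfunE s) (comp_lfunE (lact _ a)).
  rewrite (ind_lactE a x n) [s _](sE (a * x : rreg A)).
  by rewrite [X in lact _ _ X](sE x) (ind_lactE a).
apply: eq_otens => x n; rewrite (comp_lfunE (mulmap _ _)) [s _]sE.
by rewrite mulmapE ind_unitE (ind_lactE x) id_lfunE mulr1.
Qed.

Section Kernel.

Variables (M N : lmodule A) (f : 'Hom(M, N)) (fL : act_linear fullv f).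

Definition ker_act (a : A) : 'End(subvs_of (lker f)) :=
  linfun (vsproj (lker f) \o lact M a \o vsval).

Lemma ker_actE a k : vsval (ker_act a k) = lact M a (vsval k).
Proof.
rewrite lfunE /= vsprojK // memv_ker fL ?memvf //.
by have := subvsP k; rewrite memv_ker => /eqP->; rewrite linear0.
Qed.

Fact ker_act_linear : linear ker_act.
Proof.
move=> k a b; apply/lfunP=> v; apply: subvs_inj.
rewrite [RHS]/= add_lfunE scale_lfunE linearP /= !ker_actE linearP.
by rewrite add_lfunE scale_lfunE.
Qed.

HB.instance Definition _ := GRing.isLinear.Build K A _ _ ker_act ker_act_linear.

Fact ker_act1 : linfun ker_act 1 = \1%VF.
Proof.
rewrite (lfunE ker_act); apply/lfunP=> v; apply: subvs_inj.
by rewrite ker_actE lact1 !id_lfunE.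
Qed.

Fact ker_actM a b :
  linfun ker_act (a * b) = (linfun ker_act a \o linfun ker_act b)%VF.
Proof.
rewrite !(lfunE ker_act); apply/lfunP=> v; apply: subvs_inj.
by rewrite comp_lfunE !ker_actE lactM comp_lfunE.
Qed.

Definition kermod : lmodule A := LModule ker_act1 ker_actM.

Definition kinc : 'Hom(kermod, M) := linfun vsval.
Definition kproj : 'Hom(M, kermod) := linfun (vsproj (lker f)).

Lemma kincE k : kinc k = vsval k. Proof. exact: lfunE. Qed.

Lemma kinc_act : act_linear fullv kinc.
Proof.
by move=> a _ k; rewrite !kincE /= (lfunE ker_act) /= ker_actE.
Qed.

Lemma kincK k : kproj (kinc k) = k.
Proof. by rewrite kincE lfunE /= vsvalK. Qed.

Lemma kprojK m : f m = 0 -> kinc (kproj m) = m.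
Proof. by move=> fm; rewrite kincE lfunE /= vsprojK // memv_ker fm. Qed.

Lemma f_kinc k : f (kinc k) = 0.
Proof. by rewrite kincE; apply/eqP; rewrite -memv_ker subvsP. Qed.

End Kernel.

Variable M : lmodule A.

Fixpoint syz n : lmodule A :=
  if n is m.+1 then kermod (@mulmap_act (syz m)) else M.

Definition bar_obj n : lmodule A := ind B (syz n).

Definition bar_inc n : 'Hom(syz n.+1, bar_obj n) := kinc (@mulmap_act (syz n)).

Fact bar_inc_act n : act_linear fullv (bar_inc n).
Proof. exact: kinc_act. Qed.

Definition bar_diff n : 'Hom(bar_obj n.+1, bar_obj n) :=
  (bar_inc n \o mulmap B (syz n.+1))%VF.

Fact bar_diffE n q : bar_diff n q = bar_inc n (mulmap B (syz n.+1) q).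
Proof. exact: comp_lfunE. Qed.

Fact bar_diff_act n : act_linear fullv (bar_diff n).
Proof.
move=> a aA m; rewrite !bar_diffE (mulmap_act aA).
exact: bar_inc_act.
Qed.

Fact mulmap_bar n : (mulmap B (syz n) \o bar_diff n)%VF = 0.
Proof. by apply/lfunP=> q; rewrite comp_lfunE bar_diffE zero_lfunE [LHS]f_kinc. Qed.

Fact bar_comp n : (bar_diff n \o bar_diff n.+1)%VF = 0.
Proof.
by rewrite {1}/bar_diff -comp_lfunA mulmap_bar comp_lfun0r.
Qed.

Definition bar_complex : complex A := Complex bar_diff_act bar_comp.

Definition bar_proj n : 'Hom(bar_obj n, syz n.+1) :=
  (kproj (@mulmap_act (syz n)) \o (\1 - (ind_unit (syz n) \o mulmap B (syz n))))%VF.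

Fact bar_projE n q :
  bar_inc n (bar_proj n q) = q - ind_unit (syz n) (mulmap B (syz n) q).
Proof.
pose u := ind_unit (syz n); pose mu := mulmap B (syz n).
have pE : bar_proj n q = kproj (@mulmap_act (syz n)) (q - u (mu q)).
  by rewrite comp_lfunE add_lfunE opp_lfunE id_lfunE comp_lfunE.
rewrite pE; apply: kprojK; rewrite linearB /= -/mu.
have /lfunP/(_ (mu q)) := mulmap_unit (syz n).
by rewrite comp_lfunE id_lfunE => ->; rewrite subrr.
Qed.

Fact bar_inc_inj n : injective (bar_inc n).
Proof. exact: can_inj (@kincK _ _ _ (@mulmap_act (syz n))). Qed.

Fact bar_proj_inc n k : bar_proj n (bar_inc n k) = k.
Proof.
apply: (@bar_inc_inj n); rewrite bar_projE [mulmap _ _ _]f_kinc.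
by rewrite linear0 subr0.
Qed.

Fact bar_proj_act n : act_linear B (bar_proj n).
Proof.
move=> b bB q; apply: (@bar_inc_inj n).
rewrite (bar_inc_act (memvf b)) !bar_projE (mulmap_act (memvf b)) (ind_unit_act bB).
by rewrite linearB.
Qed.

Definition bar_homotopy n :
    'Hom(aug_obj bar_complex M n, aug_obj bar_complex M n.+1) :=
  if n is m.+1 return 'Hom(aug_obj bar_complex M n, aug_obj bar_complex M n.+1)
  then (ind_unit (syz m.+1) \o bar_proj m)%VF else ind_unit M.

Fact bar_exact :
  rel_exact B (augment (P := bar_complex) (@mulmap_act M) (mulmap_bar 0)).
Proof.
have unitK m k : mulmap B (syz m) (ind_unit (syz m) k) = k.
  by have /lfunP/(_ k) := mulmap_unit (syz m); rewrite comp_lfunE id_lfunE.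
have hE m q : (ind_unit (syz m.+1) \o bar_proj m)%VF q =
    ind_unit (syz m.+1) (bar_proj m q).
  exact: comp_lfunE.
exists bar_homotopy; split=> [[|n]||[|n]].
- exact: ind_unit_act.
- move=> b bB q /=.
  by rewrite !hE (bar_proj_act bB) (ind_unit_act bB).
- exact: mulmap_unit.
- apply/lfunP=> q; rewrite add_lfunE id_lfunE (comp_lfunE (bar_diff 0)).
  rewrite (comp_lfunE (ind_unit M)) hE bar_diffE unitK.
  by rewrite [bar_inc _ _]bar_projE subrK.
apply/lfunP=> q; rewrite add_lfunE id_lfunE (comp_lfunE (bar_diff n.+1)).
rewrite (comp_lfunE _ (bar_diff n)) !hE !bar_diffE unitK.
by rewrite [bar_inc _ _]bar_projE bar_proj_inc subrK.
Qed.

(* Each syzygy is the kernel of mulmap on the previous one, which ind_unit splits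
   B-linearly. *)
Definition bar_resolution : rel_resolution B M :=
  @RelResolution K A B M bar_complex (mulmap B M) (@mulmap_act M) (mulmap_bar 0)
    (fun n => ind_projective (syz n)) bar_exact.

End BarResolution.

Section Homology.

Variables (K : fieldType) (V : nat -> vectType K).
Variable d : forall n, 'Hom(V n.+1, V n).

Definition cycles n : {vspace V n} :=
  if n is m.+1 return {vspace V n} then lker (d m) else fullv.

Definition homology n : vectType K := quotv (cycles n) (limg (d n)).

End Homology.

(* H_n(X ⊗_A P), for a chosen (A,B)-projective resolution P of M.  Such a P
   exists by bar_resolution, and statements about Tor range over all P. *)
Definition Tor (K : fieldType) (A : falgType K) (B : {vspace A})
    (X : rmodule A) (M : lmodule A) (P : rel_resolution B M) (n : nat) :
    vectType K :=
  homology (fun i => omap fullv X (diff P i)) n.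

Section TensorModules.

Variables (K : fieldType) (A C : falgType K).

Section Left.

Variables (M : lmodule A) (N : lmodule C).

Definition tens_lact : 'Hom(tens A C, 'End(tens M N)) :=
  tlift (fun a c => tmap (lact M a) (lact N c)).

Lemma tens_lactE a c m n :
  tens_lact (a ⊗ c) (m ⊗ n) = lact M a m ⊗ lact N c n.
Proof.
have [tr tl] := @tmap_bilin K M N M N.
rewrite /tens_lact tliftE ?tmapE //.
by split=> [u|u] k v w; rewrite linearP; [apply: tr | apply: (tl (lact N u))].
Qed.

Fact tens_lact1 : tens_lact 1 = \1%VF.
Proof.
by apply: eq_tens => m n; rewrite tens_lactE !lact1 !id_lfunE.
Qed.

Fact tens_lactM s t : tens_lact (s * t) = (tens_lact s \o tens_lact t)%VF.
Proof.
elim/tens_ind: s => [|s s' IHs IHs'|a c].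
- by rewrite mul0r linear0 comp_lfun0l.
- by rewrite mulrDl !linearD /= IHs IHs' comp_lfunDl.
elim/tens_ind: t => [|t t' IHt IHt'|a' c'].
- by rewrite mulr0 linear0 comp_lfun0r.
- by rewrite mulrDr !linearD /= IHt IHt' comp_lfunDr.
rewrite pureM; apply: eq_tens => m n.
by rewrite comp_lfunE !tens_lactE !lactM !comp_lfunE.
Qed.

(* (a ⊗ c) (m ⊗ n) = a m ⊗ c n *)
Definition tens_lmodule : lmodule (tens A C) := LModule tens_lact1 tens_lactM.

End Left.

Section Right.

Variables (X : rmodule A) (Y : rmodule C).

Definition tens_ract : 'Hom(tens A C, 'End(tens X Y)) :=
  tlift (fun a c => tmap (ract X a) (ract Y c)).

Lemma tens_ractE a c x y :
  tens_ract (a ⊗ c) (x ⊗ y) = ract X a x ⊗ ract Y c y.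
Proof.
have [tr tl] := @tmap_bilin K X Y X Y.
rewrite /tens_ract tliftE ?tmapE //.
by split=> [u|u] k v w; rewrite linearP; [apply: tr | apply: (tl (ract Y u))].
Qed.

Fact tens_ract1 : tens_ract 1 = \1%VF.
Proof.
by apply: eq_tens => x y; rewrite tens_ractE !ract1 !id_lfunE.
Qed.

Fact tens_ractM s t : tens_ract (s * t) = (tens_ract t \o tens_ract s)%VF.
Proof.
elim/tens_ind: s => [|s s' IHs IHs'|a c].
- by rewrite mul0r linear0 comp_lfun0r.
- by rewrite mulrDl !linearD /= IHs IHs' comp_lfunDr.
elim/tens_ind: t => [|t t' IHt IHt'|a' c'].
- by rewrite mulr0 linear0 comp_lfun0l.
- by rewrite mulrDr !linearD /= IHt IHt' comp_lfunDl.
rewrite pureM; apply: eq_tens => x y.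
by rewrite comp_lfunE !tens_ractE !ractM !comp_lfunE.
Qed.

(* (x ⊗ y) (a ⊗ c) = x a ⊗ y c *)
Definition tens_rmodule : rmodule (tens A C) := RModule tens_ract1 tens_ractM.

End Right.

End TensorModules.

(* Main.v *)
(* Both sides are finite-dimensional, so it suffices to compare dimensions.  The total
   complex of P ⊗ Q, augmented to M ⊗ N, is itself an (A ⊗ C, B ⊗ D)-projective
   resolution, and relative Tor does not depend on the resolution, because a splitting
   of the multiplication A ⊗_B E -> E averages B-linear maps out of E to A-linear ones,
   which turns a contracting B-homotopy into comparison maps.  As
   (X ⊗ Y) ⊗_{A ⊗ C} (P ⊗ Q) is (X ⊗_A P) ⊗ (Y ⊗_C Q), it remains to prove the Künneth
   formula over a field, where each complex deformation retracts onto its homology.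
   The same homotopy on a tensor product of deformation retracts gives both the Künneth
   formula and the exactness of the total complex. *)

Require Import Defs.
From HB Require Import structures.
From mathcomp Require Import all_boot all_algebra falgebra separable.

Set Implicit Arguments.
Unset Strict Implicit.
Unset Printing Implicit Defensive.

Import GRing.Theory VectorInternalTheory.
Local Open Scope ring_scope.

(* all_boot exports another omap, on options. *)
Local Notation omap := Defs.omap.

(** * Linear maps and dimensions *)

Section LinearMaps.

Variable K : fieldType.
Implicit Types U V W : vectType K.

(** Two obstacles shape the proof. The homotopies that exactness provides are only [B]-linear, while
    comparison maps have to be [A]-linear. Each such map is therefore given by a recursive formula,
    the average of [h] composed with what has to be lifted; differentials, being [A]-linear, pass
    through the average and act on what is inside. The second obstacle is typing. The summands of a
    total complex are indexed by pairs (i, j) with a fixed sum, and equations between degrees would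
    force transports. Peeling off one row at a time avoids them, at the price of a shift: degree [m]
    of a total complex is [tot G m.+1], and [tot G 0] is the zero space on which inductions start.
    Working with dimensions also splits each comparison in two: chain maps in both directions and a
    homotopy on one side already bound one homology by the other, and the reverse bound follows by
    symmetry. *)

Lemma dim_inj_leq U V (f : 'Hom(U, V)) :
  (forall u, f u = 0 -> u = 0) -> (dim U <= dim V)%N.
Proof.
move=> f0; rewrite -[dim U]dimvf -[dim V]dimvf -(limg_dim_eq (f := f)).
  exact/dimvS/subvf.
apply/eqP; rewrite -subv0; apply/subvP=> u; rewrite memv_cap memv_ker memv0.
by move=> /andP[_ /eqP /f0->].
Qed.

(** Read from right to left, [hom_ofE] makes the generic [linear0], [linearD] and [linearB]
    available for unbundled maps such as [opure S x]. *)
Definition hom_of U V (f : U -> V) (fL : linear f) : 'Hom(U, V) :=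
  linfun (HB.pack_for {linear U -> V} f (GRing.isLinear.Build K U V _ f fL)).

Lemma hom_ofE U V (f : U -> V) (fL : linear f) u : hom_of fL u = f u.
Proof. exact: lfunE. Qed.

Lemma eq_dim_isomorphic U V : dim U = dim V -> isomorphic U V.
Proof.
move=> dUV.
(* This statement mentions [V] only through [dim V], so the equation can be eliminated in it; two
   identity matrices remain. *)
have [A [B [AB BA]]] :
    exists (A : 'M[K]_(dim U, dim V)) B, A *m B = 1%:M /\ B *m A = 1%:M.
  by case: _ / dUV; exists 1%:M, 1%:M; rewrite mulmx1.
pose f (u : U) : V := r2v (v2r u *m A); pose g (v : V) : U := r2v (v2r v *m B).
have fL : linear f by move=> a u v; rewrite /f linearP mulmxDl -scalemxAl linearP.
exists (hom_of fL); exists g => u; rewrite hom_ofE /f /g r2vK -mulmxA ?AB ?BA.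
  by rewrite mulmx1 v2rK.
by rewrite mulmx1 v2rK.
Qed.

Lemma lfun_bijK U V (f : 'Hom(U, V)) :
  bijective f -> cancel f f^-1%VF /\ cancel f^-1%VF f.
Proof.
move=> fbij; have fK : cancel f f^-1%VF by apply/lker0_lfunK/lker0P/bij_inj.
by split=> //; apply/(bij_can_sym fbij).
Qed.

Definition lfst U V : 'Hom((U * V)%type, U) := linfun fst.
Definition lsnd U V : 'Hom((U * V)%type, V) := linfun snd.

Lemma lfstE U V (w : U * V) : lfst U V w = w.1. Proof. exact: lfunE. Qed.
Lemma lsndE U V (w : U * V) : lsnd U V w = w.2. Proof. exact: lfunE. Qed.

Fact lpair_linear W U V (f : 'Hom(W, U)) (g : 'Hom(W, V)) :
  linear (fun w => (f w, g w) : U * V).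
Proof. by move=> a u v; rewrite !linearP. Qed.

Definition lpair W U V (f : 'Hom(W, U)) (g : 'Hom(W, V)) :=
  hom_of (lpair_linear f g).

Lemma lpairE W U V (f : 'Hom(W, U)) (g : 'Hom(W, V)) w : lpair f g w = (f w, g w).
Proof. exact: hom_ofE. Qed.

End LinearMaps.

(** * Homology of complexes of vector spaces *)

Section Homology.

Variable K : fieldType.

Lemma dim_homology (V : nat -> vectType K) (d : forall n, 'Hom(V n.+1, V n)) n :
  dim (homology d n) = \dim (cycles d n :\: limg (d n))%VS.
Proof. by []. Qed.

(** The map induced by [f] is injective on homology: if [f z] is a boundary [d' w], then [z] is the
    sum of [z - g (f z)] and [g (d' w) = d (g w)], both boundaries. *)
Lemma homology_retract (V W : nat -> vectType K)
    (d : forall n, 'Hom(V n.+1, V n)) (d' : forall n, 'Hom(W n.+1, W n))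
    (f : forall n, 'Hom(V n, W n)) (g : forall n, 'Hom(W n, V n)) n :
    (forall m v, f m (d m v) = d' m (f m.+1 v)) ->
    (forall m w, g m (d' m w) = d m (g m.+1 w)) ->
    (forall v, v \in cycles d n -> v - g n (f n v) \in limg (d n)) ->
  (dim (homology d n) <= dim (homology d' n))%N.
Proof.
move=> fd gd fg.
pose phi : 'Hom(homology d n, homology d' n) :=
  (qproj (cycles d' n) (limg (d' n)) \o (f n \o qsec (cycles d n) (limg (d n))))%VF.
apply: (dim_inj_leq (f := phi)) => q.
have qZ := qsec_mem q; rewrite /phi !comp_lfunE.
have fZ v : v \in cycles d n -> f n v \in cycles d' n.
  case: n {fg phi q qZ} v => [|m] v; first by move=> _; exact: memvf.
  by rewrite !memv_ker -fd => /eqP->; rewrite linear0.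
move/eqP; rewrite qproj_eq0 ?fZ // => /memv_imgP[w _ fw].
have := fg _ qZ; rewrite fw gd => dv.
have : qsec _ _ q \in limg (d n).
  by rewrite -[X in X \in _](subrK (d n (g n.+1 w))) rpredD // memv_img ?memvf.
by rewrite -(qproj_eq0 _ qZ) qsecK => /eqP.
Qed.

Lemma homology_iso (V W : nat -> vectType K)
    (d : forall n, 'Hom(V n.+1, V n)) (d' : forall n, 'Hom(W n.+1, W n))
    (f : forall n, 'Hom(V n, W n)) n :
    (forall m v, f m (d m v) = d' m (f m.+1 v)) -> (forall m, bijective (f m)) ->
  dim (homology d n) = dim (homology d' n).
Proof.
move=> fd fbij; pose g m := (f m)^-1%VF.
have fK m : cancel (f m) (g m) := proj1 (lfun_bijK (fbij m)).
have gK m : cancel (g m) (f m) := proj2 (lfun_bijK (fbij m)).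
have gd m w : g m (d' m w) = d m (g m.+1 w) by rewrite -{1}[w]gK -fd fK.
apply/eqP; rewrite eqn_leq (homology_retract fd gd) ?(homology_retract gd fd) //.
  by move=> w _; rewrite gK subrr mem0v.
by move=> v _; rewrite fK subrr mem0v.
Qed.

Lemma dim_homology0 (V : nat -> vectType K) (d : forall n, 'Hom(V n.+1, V n)) n :
  (forall m, d m = 0) -> dim (homology d n) = dim (V n).
Proof.
move=> d0; have Z : cycles d n = fullv.
  by case: n => //= n; rewrite d0; apply/vspaceP=> v;
    rewrite memv_ker zero_lfunE eqxx memvf.
have B : limg (d n) = 0%VS.
  apply/eqP; rewrite -subv0; apply/subvP=> _ /memv_imgP[v _ ->].
  by rewrite d0 zero_lfunE mem0v.
by have := dimv_cap_compl {:V n} 0; rewrite dim_homology Z B capv0 dimv0 dimvf.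
Qed.

(** Over a field every complex splits. The pseudo-inverse of [d] is a section over its image, and
    both the projection to homology and the homotopy are built from it. *)
Lemma homology_deformation (V : nat -> vectType K)
    (d : forall n, 'Hom(V n.+1, V n)) :
    (forall n v, d n (d n.+1 v) = 0) ->
  exists (p : forall n, 'Hom(V n, homology d n))
         (i : forall n, 'Hom(homology d n, V n)) (k : forall n, 'Hom(V n, V n.+1)),
    [/\ forall n, cancel (i n) (p n), forall n v, p n (d n v) = 0,
        forall n q, d n (i n.+1 q) = 0,
        forall v, d 0%N (k 0%N v) = v - i 0%N (p 0%N v) &
        forall n v, d n.+1 (k n.+1 v) + k n (d n v) = v - i n.+1 (p n.+1 v)].
Proof.
move=> dd; pose q n := qproj (cycles d n) (limg (d n)).
pose i n : 'Hom(homology d n, V n) := qsec (cycles d n) (limg (d n)).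
(* A projection onto the cycles: subtracting a chosen preimage of [d v] leaves a cycle, and cycles
   are left unchanged. *)
pose z n : 'End(V n) := if n is m.+1 return 'End(V n)
  then (\1 - ((d m)^-1 \o d m))%VF else \1%VF.
pose p n : 'Hom(V n, homology d n) := (q n \o z n)%VF.
have q0 n v : v \in cycles d n -> (q n v == 0) = (v \in limg (d n)).
  exact: qproj_eq0.
have iK n : cancel (i n) (q n) by exact: qsecK.
have iZ n h : i n h \in cycles d n by exact: qsec_mem.
have iq n v : v \in cycles d n -> v - i n (q n v) \in limg (d n).
  by move=> vZ; apply: qsec_qproj; apply: subvP (addvSl _ _) _ vZ.
have dV n v : d n ((d n)^-1%VF (d n v)) = d n v.
  by rewrite limg_lfunVK // memv_img ?memvf.
have dZ n v : d n v \in cycles d n.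
  by case: n v => [|n] v; rewrite ?memvf // memv_ker dd.
have zZ n v : z n v \in cycles d n.
  case: n v => [|n] v; rewrite ?memvf // memv_ker.
  by rewrite add_lfunE opp_lfunE id_lfunE comp_lfunE linearB /= dV subrr.
have zK n v : v \in cycles d n -> z n v = v.
  case: n v => [|n] v /=; rewrite ?id_lfunE // memv_ker => /eqP dv0.
  by rewrite add_lfunE opp_lfunE id_lfunE comp_lfunE dv0 linear0 subr0.
have pd n v : p n (d n v) = 0.
  by apply/eqP; rewrite comp_lfunE zK ?q0 ?dZ // memv_img ?memvf.
have zB n v : z n v - i n (p n v) \in limg (d n).
  by rewrite comp_lfunE iq ?zZ.
(* The values of [z - i p] are boundaries, where the pseudo-inverse of [d] really is a section. *)
pose k n : 'Hom(V n, V n.+1) := ((d n)^-1 \o (z n - (i n \o p n)))%VF.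
have dk n v : d n (k n v) = z n v - i n (p n v).
  have kE : (z n - (i n \o p n))%VF v = z n v - i n (p n v).
    by rewrite add_lfunE opp_lfunE (comp_lfunE (i n)).
  by rewrite comp_lfunE kE limg_lfunVK ?zB.
exists p, i, k; split=> //.
- by move=> n h; rewrite comp_lfunE zK ?iZ ?iK.
- by move=> n h; apply/eqP; rewrite -memv_ker; apply: (iZ n.+1).
- by move=> v; rewrite dk id_lfunE.
(* On boundaries [z] is the identity and [p] vanishes, so [k d] is exactly the part that [z]
   removes. *)
move=> n v; rewrite dk; have -> : k n (d n v) = (d n)^-1%VF (d n v).
  rewrite comp_lfunE add_lfunE opp_lfunE (comp_lfunE (i n)) pd.
  by rewrite linear0 subr0 zK ?dZ.
by rewrite [z n.+1 v]add_lfunE opp_lfunE id_lfunE comp_lfunE addrAC subrK.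
Qed.

End Homology.

(** * Averaging and the comparison of relative resolutions *)

Section RelativeComparison.

Variables (K : fieldType) (A : falgType K).
Implicit Types (S B : {vspace A}) (E L M N : lmodule A).

Lemma act_linear_comp S L M N (f : 'Hom(M, N)) (g : 'Hom(L, M)) :
  act_linear S f -> act_linear S g -> act_linear S (f \o g)%VF.
Proof. by move=> fS gS a aS m; rewrite !(comp_lfunE f) gS ?fS. Qed.

Lemma act_linearD S M N (f g : 'Hom(M, N)) :
  act_linear S f -> act_linear S g -> act_linear S (f + g).
Proof. by move=> fS gS a aS m; rewrite !add_lfunE linearD fS ?gS. Qed.

Lemma act_linearN S M N (f : 'Hom(M, N)) : act_linear S f -> act_linear S (- f).
Proof. by move=> fS a aS m; rewrite !opp_lfunE linearN fS. Qed.

Lemma act_linearZ S M N k (f : 'Hom(M, N)) :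
  act_linear S f -> act_linear S (k *: f).
Proof. by move=> fS a aS m; rewrite !scale_lfunE linearZ /= fS. Qed.

Lemma act_linear0 S M N : act_linear S (0 : 'Hom(M, N)).
Proof. by move=> a aS m; rewrite !zero_lfunE linear0. Qed.

Lemma act_linear1 S M : act_linear S (\1%VF : 'End(M)).
Proof. by move=> a aS m; rewrite !id_lfunE. Qed.

Lemma act_linear_full S M N (f : 'Hom(M, N)) :
  act_linear fullv f -> act_linear S f.
Proof. by move=> fA a _ m; rewrite fA ?memvf. Qed.

Lemma omap_act_linear S M N (f : 'Hom(M, N)) :
  act_linear S f -> act_linear fullv (omap S (rreg A) f : 'Hom(ind S M, ind S N)).
Proof.
move=> fS a _ m; set F : 'Hom(ind S M, ind S N) := omap S (rreg A) f.
suff /lfunP/(_ m) : (F \o lact (ind S M) a = lact (ind S N) a \o F)%VF.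
  by rewrite (comp_lfunE F) (comp_lfunE (lact _ a)).
apply: eq_otens => x n; rewrite (comp_lfunE F) (comp_lfunE (lact _ a)).
by rewrite ind_lactE /F !omapE // ind_lactE.
Qed.

(* The relative analogue of averaging over a group: A and B play the roles of the group
   algebra and its base ring, s that of the sum of the g ⊗ g^-1 over the group order. *)
Definition avg B E L (s : 'Hom(E, ind B E)) (f : 'Hom(E, L)) : 'Hom(E, L) :=
  (mulmap B L \o ((omap B (rreg A) f : 'Hom(ind B E, ind B L)) \o s))%VF.

Lemma avgE B E L (s : 'Hom(E, ind B E)) (f : 'Hom(E, L)) x :
  avg s f x = mulmap B L (omap B (rreg A) f (s x)).
Proof.
by rewrite comp_lfunE (comp_lfunE (omap B (rreg A) f : 'Hom(ind B E, ind B L))).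
Qed.

Lemma avg_act_linear B E L (s : 'Hom(E, ind B E)) (f : 'Hom(E, L)) :
  act_linear fullv s -> act_linear B f -> act_linear fullv (avg s f).
Proof.
move=> sA fB; apply: act_linear_comp; first exact: mulmap_act.
by apply: act_linear_comp => //; apply: omap_act_linear.
Qed.

(** On [a ⊗ m] both sides give [a (t (f m))]. *)
Lemma avg_natural B E L L' (s : 'Hom(E, ind B E)) (f : 'Hom(E, L))
    (t : 'Hom(L, L')) x :
    act_linear B f -> act_linear fullv t ->
  t (avg s f x) = avg s (t \o f)%VF x.
Proof.
move=> fB tA; rewrite !avgE; move: (s x) => y.
have tfB : act_linear B (t \o f)%VF.
  by apply: act_linear_comp => //; apply: act_linear_full.
set F : 'Hom(ind B E, ind B L) := omap B (rreg A) f.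
set G : 'Hom(ind B E, ind B L') := omap B (rreg A) (t \o f)%VF.
suff /lfunP/(_ y) : (t \o (mulmap B L \o F) = mulmap B L' \o G)%VF.
  by rewrite (comp_lfunE t) (comp_lfunE (mulmap B L)) (comp_lfunE (mulmap B L')).
apply: eq_otens => a m.
rewrite (comp_lfunE t) (comp_lfunE (mulmap B L)) (comp_lfunE (mulmap B L')).
by rewrite /F /G !omapE // !mulmapE tA ?memvf // comp_lfunE.
Qed.

(** As [a (f m) = f (a m)], an [A]-linear [f] comes out of the average and leaves [mulmap] after
    [s], the identity. *)
Lemma avg_id B E L (s : 'Hom(E, ind B E)) (f : 'Hom(E, L)) x :
  (mulmap B E \o s)%VF = \1%VF -> act_linear fullv f -> avg s f x = f x.
Proof.
move=> sK fA; have fB := @act_linear_full B _ _ _ fA; rewrite avgE.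
have /lfunP/(_ x) := sK; rewrite comp_lfunE id_lfunE => {2}<-.
move: (s x) => y.
set F : 'Hom(ind B E, ind B L) := omap B (rreg A) f.
suff /lfunP/(_ y) : (mulmap B L \o F = f \o mulmap B E)%VF.
  by rewrite (comp_lfunE (mulmap B L)) (comp_lfunE f).
apply: eq_otens => a m; rewrite (comp_lfunE (mulmap B L)) (comp_lfunE f).
by rewrite /F omapE // !mulmapE fA ?memvf.
Qed.

(** Testing on a basis makes [A]-linearity decidable, so that [xchoose] can select the splittings of
    infinitely many modules at once. *)
Lemma act_linear_boolP M N (f : 'Hom(M, N)) :
  reflect (act_linear fullv f)
    (all (fun a => (f \o lact M a == lact N a \o f)%VF) (vbasis {:A})).
Proof.
apply: (iffP allP) => [fb a _ m | fA a _]; last first.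
  by apply/eqP/lfunP=> m; rewrite (comp_lfunE f) comp_lfunE fA ?memvf.
rewrite [a](coord_vbasis (memvf a)) !linear_sum !sum_lfunE linear_sum /=.
apply: eq_bigr => i _; rewrite !linearZ !scale_lfunE linearZ /=; congr (_ *: _).
have bi : (vbasis {:A})`_i \in vbasis {:A} by rewrite mem_nth ?size_tuple.
by have /lfunP/(_ m) := eqP (fb _ bi); rewrite (comp_lfunE f) comp_lfunE.
Qed.

Lemma rel_projective_split B (P : nat -> lmodule A) :
    (forall n, rel_projective B (P n)) ->
  exists2 s : forall n, 'Hom(P n, ind B (P n)),
    forall n, act_linear fullv (s n) & forall n, (mulmap B (P n) \o s n)%VF = \1%VF.
Proof.
move=> proj.
have ex n : exists s : 'Hom(P n, ind B (P n)),
    all (fun a => (s \o lact (P n) a == lact (ind B (P n)) a \o s)%VF) (vbasis {:A})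
      && (mulmap B (P n) \o s == \1)%VF.
  by have [s sA sK] := proj n; exists s; rewrite sK eqxx andbT; apply/act_linear_boolP.
exists (fun n => xchoose (ex n)) => n.
  by have /andP[/act_linear_boolP] := xchooseP (ex n).
by have /andP[_ /eqP] := xchooseP (ex n).
Qed.

Lemma diffK (C : complex A) n x : diff C n (diff C n.+1 x) = 0.
Proof. by have /lfunP/(_ x) := diff_comp C n; rewrite comp_lfunE zero_lfunE. Qed.

Section Lift.

Variables (B : {vspace A}) (C C' : complex A).
Hypotheses (Cproj : forall n, rel_projective B (C n.+1)) (C'ex : rel_exact B C').

(** The next map is the average of [h f d]. As [d'] passes inside, it yields the average of
    [d' h f d = f d], which is [f d] because this map is [A]-linear. Both complexes are meant to be
    augmented, with the resolved module in degree 0; this is why projectivity is assumed from degree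
    1 on. *)
Lemma rel_lift (f0 : 'Hom(C 0%N, C' 0%N)) :
    act_linear fullv f0 ->
  exists f : forall n, 'Hom(C n, C' n),
    [/\ f 0%N = f0, forall n, act_linear fullv (f n) &
        forall n x, diff C' n (f n.+1 x) = f n (diff C n x)].
Proof.
move=> f0A; have [s sA sK] := rel_projective_split Cproj.
have [h [hB h0 hS]] := C'ex.
have hE n y : diff C' n.+1 (h n.+1 y) + h n (diff C' n y) = y.
  by have /lfunP/(_ y) := hS n; rewrite add_lfunE id_lfunE !comp_lfunE.
pose fix f n : 'Hom(C n, C' n) := if n is m.+1 return 'Hom(C n, C' n)
  then avg (s m) (h m \o (f m \o diff C m))%VF else f0.
have fdA n : act_linear fullv (f n) -> act_linear fullv (f n \o diff C n)%VF.
  by move=> fA; apply: act_linear_comp => //; apply: diff_linear.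
have hfB n : act_linear fullv (f n) -> act_linear B (h n \o (f n \o diff C n))%VF.
  by move=> fA; apply: act_linear_comp (hB n) (act_linear_full (fdA n fA)).
have fA n : act_linear fullv (f n).
  by elim: n => [|n IHn] //; apply: avg_act_linear => //; apply: hfB.
exists f; split=> // n.
(* The values of [f d] are cycles, on which the homotopy identity makes [h] a section of [d']. *)
suff dhf y : diff C' n (h n (f n (diff C n y))) = f n (diff C n y).
  move=> x; have -> : f n (diff C n x) = avg (s n) (f n \o diff C n)%VF x.
    by rewrite avg_id ?comp_lfunE //; apply: fdA.
  rewrite [f n.+1 x]/= avg_natural; last by apply: diff_linear.
    congr (fun_of_lfun (avg _ _) _); apply/lfunP=> y.
    by rewrite !comp_lfunE dhf.
  exact: hfB.
elim: n y => [|n IHn] y.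
  by have /lfunP/(_ (f 0%N (diff C 0 y))) := h0; rewrite comp_lfunE id_lfunE.
rewrite -[RHS]hE.
rewrite -[LHS]addr0; congr (_ + _).
rewrite [f n.+1 _]/= avg_natural; last by apply: diff_linear.
  rewrite (_ : (_ \o _)%VF = f n \o diff C n)%VF; last first.
    by apply/lfunP=> z; rewrite !comp_lfunE IHn.
  by rewrite avg_id ?comp_lfunE ?diffK ?linear0 //; apply: fdA.
exact: hfB.
Qed.

(** The homotopy is the average of [h (f - k d)], where [k] is the map built one degree below; the
    averaging argument is the one that produces the lift. *)
Lemma rel_homotopy (f : forall n, 'Hom(C n, C' n)) :
    f 0%N = 0 -> (forall n, act_linear fullv (f n)) ->
    (forall n x, diff C' n (f n.+1 x) = f n (diff C n x)) ->
  exists k : forall n, 'Hom(C n, C' n.+1),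
    [/\ k 0%N = 0, forall n, act_linear fullv (k n) &
        forall n x, f n.+1 x = diff C' n.+1 (k n.+1 x) + k n (diff C n x)].
Proof.
move=> f0 fA fd; have [s sA sK] := rel_projective_split Cproj.
have [h [hB h0 hS]] := C'ex.
have hE n y : diff C' n.+1 (h n.+1 y) + h n (diff C' n y) = y.
  by have /lfunP/(_ y) := hS n; rewrite add_lfunE id_lfunE !comp_lfunE.
pose fix k n : 'Hom(C n, C' n.+1) := if n is m.+1 return 'Hom(C n, C' n.+1)
  then avg (s m) (h m.+1 \o (f m.+1 - (k m \o diff C m)))%VF else 0.
have gA n : act_linear fullv (k n) ->
    act_linear fullv (f n.+1 - (k n \o diff C n))%VF.
  move=> kA; apply: act_linearD => //; apply: act_linearN.
  by apply: act_linear_comp => //; apply: diff_linear.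
have hgB n : act_linear fullv (k n) ->
    act_linear B (h n.+1 \o (f n.+1 - (k n \o diff C n)))%VF.
  by move=> kA; apply: act_linear_comp (hB n.+1) (act_linear_full (gA n kA)).
have kA n : act_linear fullv (k n).
  elim: n => [|n IHn]; first exact: act_linear0.
  by apply: avg_act_linear => //; apply: hgB.
exists k; split=> // n.
(* The remaining error [f - k d] takes values in cycles: [d' f = f d], and by induction
   [f d = (d' k + k d) d = d' k d]. *)
suff dg y : diff C' n (f n.+1 y - k n (diff C n y)) = 0.
  move=> x; rewrite [k n.+1 x]/= avg_natural; last by apply: diff_linear.
    rewrite (_ : (_ \o _)%VF = f n.+1 - (k n \o diff C n)%VF); last first.
      apply/lfunP=> y; rewrite !comp_lfunE add_lfunE opp_lfunE comp_lfunE.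
      by rewrite -[RHS]hE dg linear0 addr0.
    rewrite avg_id //; last exact: gA.
    by rewrite add_lfunE opp_lfunE comp_lfunE subrK.
  exact: hgB.
elim: n y => [|n IHn] y; rewrite linearB /= fd.
  by rewrite f0 !zero_lfunE linear0 subr0.
have fnE : f n.+1 (diff C n.+1 y) = diff C' n.+1 (k n.+1 (diff C n.+1 y)).
  rewrite [k n.+1 _]/= avg_natural; last by apply: diff_linear.
    rewrite (_ : (_ \o _)%VF = f n.+1 - (k n \o diff C n)%VF); last first.
      apply/lfunP=> z; rewrite !comp_lfunE add_lfunE opp_lfunE comp_lfunE.
      by rewrite -[RHS]hE IHn linear0 addr0.
    rewrite avg_id //; last exact: gA.
    by rewrite add_lfunE opp_lfunE comp_lfunE diffK linear0 subr0.
  exact: hgB.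
by rewrite fnE subrr.
Qed.

End Lift.

End RelativeComparison.

(** * Independence of the resolution *)

Section TorIndependence.

Variables (K : fieldType) (A : falgType K) (B : {vspace A}).
Variables (X : rmodule A) (M : lmodule A).
Implicit Types (S : {vspace A}) (L N : lmodule A).

Lemma omapD S L N (f g : 'Hom(L, N)) : act_linear S f -> act_linear S g ->
  omap S X (f + g) = omap S X f + omap S X g.
Proof.
move=> fS gS; apply: eq_otens => x m; rewrite add_lfunE !omapE ?add_lfunE //.
  have oL := proj1 (opure_bilin S X N) x.
  by rewrite -!(hom_ofE oL) linearD.
exact: act_linearD.
Qed.

Lemma omap_comp S L N (N' : lmodule A) (f : 'Hom(N, N')) (g : 'Hom(L, N)) x :
    act_linear S f -> act_linear S g ->
  omap S X f (omap S X g x) = omap S X (f \o g)%VF x.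
Proof.
move=> fS gS; rewrite -comp_lfunE; congr (fun_of_lfun _ _); apply: eq_otens => {}x m.
by rewrite comp_lfunE !omapE ?comp_lfunE //; apply: act_linear_comp.
Qed.

Lemma omap1 S L : omap S X (\1%VF : 'End(L)) = \1%VF.
Proof.
by apply: eq_otens => x m; rewrite omapE ?id_lfunE //; apply: act_linear1.
Qed.

Lemma omap0 S L N : omap S X (0 : 'Hom(L, N)) = 0.
Proof.
apply: eq_otens => x m; rewrite omapE ?zero_lfunE; last exact: act_linear0.
by rewrite -(hom_ofE (proj1 (opure_bilin S X N) x)) linear0.
Qed.

(** Lift the identity of [M] to [f] and [g] in the two directions. Then [1 - g f] vanishes on [M],
    hence is null-homotopic by [A]-linear maps, and such a homotopy survives tensoring with [X]. *)
Lemma dim_Tor_leq (P Q : rel_resolution B M) n :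
  (dim (Tor X P n) <= dim (Tor X Q n))%N.
Proof.
pose aug_res (R : rel_resolution B M) := augment (@aug_lin _ _ _ _ R) (aug_diff0 R).
have proj (R : rel_resolution B M) m : rel_projective B (aug_res R m.+1).
  exact: res_proj.
have Pp := proj P; have Qp := proj Q.
have [f [f0 fA fd]] := rel_lift Pp (res_exact Q) (@act_linear1 _ _ fullv M).
have [g [g0 gA gd]] := rel_lift Qp (res_exact P) (@act_linear1 _ _ fullv M).
pose t m := \1%VF - (g m \o f m)%VF.
have tA m : act_linear fullv (t m).
  apply: act_linearD; first exact: act_linear1.
  by apply: act_linearN; apply: act_linear_comp.
have [|m x|k [k0 kA kt]] := rel_homotopy Pp (res_exact P) (f := t) _ tA.
- by rewrite /t f0 g0; apply/lfunP=> m; rewrite !lfun_simp subrr.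
- by rewrite !add_lfunE !opp_lfunE !id_lfunE !(comp_lfunE (g _)) linearB /= gd fd.
(* Degree [m.+1] of an augmented complex is degree [m] of the resolution by conversion; the type
   ascriptions select the second reading. *)
have kP m : act_linear fullv (k m.+1 : 'Hom(P m, P m.+1)) := kA m.+1.
have gP m : act_linear fullv (g m.+1 : 'Hom(Q m, P m)) := gA m.+1.
have fQ m : act_linear fullv (f m.+1 : 'Hom(P m, Q m)) := fA m.+1.
have dA (R : rel_resolution B M) m : act_linear fullv (diff R m).
  exact: diff_linear.
apply: (homology_retract (f := fun m => omap fullv X (f m.+1 : 'Hom(P m, Q m)))
                         (g := fun m => omap fullv X (g m.+1 : 'Hom(Q m, P m)))).
- move=> m v; rewrite !omap_comp //; congr (fun_of_lfun (omap _ _ _) _).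
  by apply/lfunP=> x; rewrite !comp_lfunE -(fd m.+1).
- move=> m v; rewrite !omap_comp //; congr (fun_of_lfun (omap _ _ _) _).
  by apply/lfunP=> x; rewrite !comp_lfunE -(gd m.+1).
have tP : act_linear fullv (t n.+1 : 'End(P n)) := tA n.+1.
move=> v vZ.
have -> : v - omap fullv X (g n.+1 : 'Hom(Q n, P n))
                (omap fullv X (f n.+1 : 'Hom(P n, Q n)) v) =
    omap fullv X (t n.+1 : 'End(P n)) v.
  apply/(canLR (addrK _)); rewrite omap_comp // -add_lfunE -omapD //.
    by rewrite subrK omap1 id_lfunE.
  exact: act_linear_comp.
(* In degree 0 the homotopy has a term that passes through [M]; it disappears because [k 0 = 0]. *)
case: n {tP} v vZ => [|n] v vZ.
  have -> : (t 1%N : 'End(P 0%N)) = (diff P 0 \o (k 1%N : 'Hom(P 0%N, P 1%N)))%VF.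
    by apply/lfunP=> x; rewrite kt k0 zero_lfunE addr0 comp_lfunE.
  by rewrite -omap_comp // memv_img ?memvf.
have -> : (t n.+2 : 'End(P n.+1)) =
    (diff P n.+1 \o (k n.+2 : 'Hom(P n.+1, P n.+2)))%VF +
    ((k n.+1 : 'Hom(P n, P n.+1)) \o diff P n)%VF.
  by apply/lfunP=> x; rewrite kt add_lfunE !comp_lfunE.
rewrite omapD ?add_lfunE; [|exact: act_linear_comp..].
rewrite -(omap_comp v (dA P n.+1) (kP n.+1)) -(omap_comp v (kP n) (dA P n)).
move: vZ; rewrite memv_ker => /eqP->.
by rewrite linear0 addr0 memv_img ?memvf.
Qed.

Lemma eq_dim_Tor (P Q : rel_resolution B M) n :
  dim (Tor X P n) = dim (Tor X Q n).
Proof. by apply/eqP; rewrite eqn_leq !dim_Tor_leq. Qed.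

End TorIndependence.

(** * Total complexes of double complexes *)

Section TotalComplex.

Variable K : fieldType.

(* The direct sum of the G i j with i + j + 1 = n; splitting off the row i = 0
   and shifting the others avoids transports along equations between degrees. *)
Fixpoint tot (G : nat -> nat -> vectType K) n : vectType K :=
  if n is m.+1 then (G 0%N m * tot (fun i => G i.+1) m)%type : vectType K
  else 'rV[K]_0.

Implicit Type G : nat -> nat -> vectType K.

Lemma tot0_eq G (u v : tot G 0) : u = v.
Proof. exact: (etrans (thinmx0 u) (esym (thinmx0 v))). Qed.

Lemma dim_tot G n : dim (tot G n.+1) = (\sum_(i < n.+1) dim (G i (n - i)))%N.
Proof.
elim: n G => [|n IHn] G; first by rewrite big_ord1; apply: addn0.
have -> : dim (tot G n.+2) =
  (dim (G 0%N n.+1) + dim (tot (fun i => G i.+1) n.+1))%N by [].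
by rewrite big_ord_recl IHn.
Qed.

Fixpoint totmap G G' (f : forall i j, 'Hom(G i j, G' i j)) n :
    'Hom(tot G n, tot G' n) :=
  if n is m.+1 return 'Hom(tot G n, tot G' n) then
    lpair (f 0%N m \o lfst _ _)%VF (totmap (fun i => f i.+1) m \o lsnd _ _)%VF
  else 0.

#[global] Arguments totmap : simpl never.

Lemma totmapE G G' (f : forall i j, 'Hom(G i j, G' i j)) n z :
  totmap f n.+1 z = (f 0%N n z.1, totmap (fun i => f i.+1) n z.2).
Proof. by rewrite [LHS]lpairE !comp_lfunE lfstE lsndE. Qed.

Fixpoint totup G (w : forall i j, 'Hom(G i j, G i j.+1)) n :
    'Hom(tot G n, tot G n.+1) :=
  if n is m.+1 return 'Hom(tot G n, tot G n.+1) then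
    lpair (w 0%N m \o lfst _ _)%VF (totup (fun i => w i.+1) m \o lsnd _ _)%VF
  else 0.

#[global] Arguments totup : simpl never.

Lemma totupE G (w : forall i j, 'Hom(G i j, G i j.+1)) n z :
  totup w n.+1 z = (w 0%N n z.1, totup (fun i => w i.+1) n z.2).
Proof. by rewrite [LHS]lpairE !comp_lfunE lfstE lsndE. Qed.

Lemma totup0 G (w : forall i j, 'Hom(G i j, G i j.+1)) z : totup w 0%N z = 0.
Proof. exact: zero_lfunE. Qed.

(** At 0 the target is the zero space, so that the homotopy identities below also cover degree 0 of
    the total complex, which is [tot G 1]. *)
Fixpoint totd G (dh : forall i j, 'Hom(G i.+1 j, G i j))
    (dv : forall i j, 'Hom(G i j.+1, G i j)) n : 'Hom(tot G n.+1, tot G n) :=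
  if n is m.+1 return 'Hom(tot G n.+1, tot G n) then
    lpair ((dv 0%N m \o lfst _ _) + (dh 0%N m \o (lfst _ _ \o lsnd _ _)))%VF
      (totd (fun i => dh i.+1) (fun i => dv i.+1) m \o lsnd _ _)%VF
  else 0.

#[global] Arguments totd : simpl never.

Lemma totdE G (dh : forall i j, 'Hom(G i.+1 j, G i j))
    (dv : forall i j, 'Hom(G i j.+1, G i j)) n z :
  totd dh dv n.+1 z = (dv 0%N n z.1 + dh 0%N n z.2.1,
    totd (fun i => dh i.+1) (fun i => dv i.+1) n z.2).
Proof. by rewrite [LHS]lpairE add_lfunE !comp_lfunE !lfstE !lsndE. Qed.

Lemma totmap_id G (f : forall i j, 'Hom(G i j, G i j)) n z :
  (forall i j x, f i j x = x) -> totmap f n z = z.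
Proof.
elim: n G f z => [|n IHn] G f z f1; first exact: tot0_eq.
by rewrite totmapE f1 IHn //; case: z.
Qed.

Lemma totmap_bij G G' (f : forall i j, 'Hom(G i j, G' i j)) n :
  (forall i j, bijective (f i j)) -> bijective (totmap f n).
Proof.
elim: n G G' f => [|n IHn] G G' f fbij.
  by exists (fun=> 0) => z; apply: tot0_eq.
have [g fK gK] := fbij 0%N n; have [h hK Kh] := IHn _ _ _ (fun i => fbij i.+1).
exists (fun w : tot G' n.+1 => (g w.1, h w.2) : tot G n.+1) => [[x y]|[x y]].
  by rewrite totmapE /= fK hK.
by rewrite totmapE /= gK Kh.
Qed.

Lemma totmap_eq0 G G' (f : forall i j, 'Hom(G i j, G' i j)) n z :
  (forall i j, f i j = 0) -> totmap f n z = 0.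
Proof.
elim: n G G' f z => [|n IHn] G G' f z f0; first exact: tot0_eq.
by rewrite totmapE f0 zero_lfunE IHn.
Qed.

Lemma totmap_comp G G' G'' (f : forall i j, 'Hom(G' i j, G'' i j))
    (g : forall i j, 'Hom(G i j, G' i j)) (h : forall i j, 'Hom(G i j, G'' i j)) n z :
  (forall i j x, f i j (g i j x) = h i j x) ->
  totmap f n (totmap g n z) = totmap h n z.
Proof.
elim: n G G' G'' f g h z => [|n IHn] G G' G'' f g h z fg; first exact: tot0_eq.
by rewrite !totmapE fg (IHn _ _ _ _ _ (fun i => h i.+1)).
Qed.

Lemma totmap_totd G G' (dh : forall i j, 'Hom(G i.+1 j, G i j))
    (dv : forall i j, 'Hom(G i j.+1, G i j))
    (dh' : forall i j, 'Hom(G' i.+1 j, G' i j))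
    (dv' : forall i j, 'Hom(G' i j.+1, G' i j))
    (f : forall i j, 'Hom(G i j, G' i j)) n z :
    (forall i j x, f i j (dh i j x) = dh' i j (f i.+1 j x)) ->
    (forall i j x, f i j (dv i j x) = dv' i j (f i j.+1 x)) ->
  totmap f n (totd dh dv n z) = totd dh' dv' n (totmap f n.+1 z).
Proof.
elim: n G G' dh dv dh' dv' f z => [|n IHn] G G' dh dv dh' dv' f z fh fv.
  exact: tot0_eq.
rewrite totdE !totmapE totdE; congr (_, _); first by rewrite linearD /= fh fv.
by rewrite (IHn _ _ _ _ (fun i => dh' i.+1) (fun i => dv' i.+1)) // totmapE.
Qed.

(* dh and dv anticommute, which keeps signs out of totd. *)
Definition double_complex G (dh : forall i j, 'Hom(G i.+1 j, G i j))
    (dv : forall i j, 'Hom(G i j.+1, G i j)) : Prop :=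
  [/\ forall i j x, dh i j (dh i.+1 j x) = 0, forall i j x, dv i j (dv i j.+1 x) = 0
    & forall i j x, dv i j (dh i j.+1 x) = - dh i j (dv i.+1 j x)].

Lemma totd0 G (dh : forall i j, 'Hom(G i.+1 j, G i j))
    (dv : forall i j, 'Hom(G i j.+1, G i j)) n z :
    (forall i j x, dh i j x = 0) -> (forall i j x, dv i j x = 0) ->
  totd dh dv n z = 0.
Proof.
elim: n G dh dv z => [|n IHn] G dh dv z h0 v0; first exact: tot0_eq.
by rewrite totdE h0 v0 addr0 IHn.
Qed.

Lemma totdK G (dh : forall i j, 'Hom(G i.+1 j, G i j))
    (dv : forall i j, 'Hom(G i j.+1, G i j)) n z :
  double_complex dh dv -> totd dh dv n (totd dh dv n.+1 z) = 0.
Proof.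
elim: n G dh dv z => [|n IHn] G dh dv z [hh vv hv]; first exact: tot0_eq.
rewrite (totdE dh dv z) totdE /= IHn; last by split=> *; rewrite ?hh ?vv ?hv.
by rewrite totdE /= !linearD /= vv hv hh addr0 add0r addNr.
Qed.

(* On V ⊗ W, with homotopies h and h' from p and p' to the identity, k is h ⊗ 1 and w is
   p ⊗ h' up to sign; u and uu below are then p ⊗ 1 and p ⊗ p'. *)
Definition tothom G (k : forall i j, 'Hom(G i j, G i.+1 j))
    (w : forall i j, 'Hom(G i j, G i j.+1)) n : 'Hom(tot G n, tot G n.+1) :=
  lpair 0 (totmap k n : 'Hom(_, tot (fun i => G i.+1) n)) + totup w n.

Lemma tothomE G (k : forall i j, 'Hom(G i j, G i.+1 j))
    (w : forall i j, 'Hom(G i j, G i j.+1)) n z :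
  tothom k w n z = (0, totmap k n z : tot (fun i => G i.+1) n) + totup w n z.
Proof. by rewrite add_lfunE lpairE zero_lfunE. Qed.

(** Since [k] raises the row index, its values lie in the rows from 1 on, whence the shifted
    differentials and the restriction to [z.2]. The vertical terms cancel by anticommutation. *)
Lemma totmap_homotopy G (dh : forall i j, 'Hom(G i.+1 j, G i j))
    (dv : forall i j, 'Hom(G i j.+1, G i j))
    (k : forall i j, 'Hom(G i j, G i.+1 j)) (u : forall i j, 'Hom(G i j, G i j)) n z :
    (forall i j x, dh i.+1 j (k i.+1 j x) + k i j (dh i j x) = x - u i.+1 j x) ->
    (forall i j x, dv i.+1 j (k i j.+1 x) = - k i j (dv i j x)) ->
  totd (fun i => dh i.+1) (fun i => dv i.+1) n (totmap k n.+1 z)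
    + totmap k n (totd dh dv n z) = z.2 - totmap (fun i => u i.+1) n z.2.
Proof.
elim: n G dh dv k u z => [|n IHn] G dh dv k u z hk vk; first exact: tot0_eq.
rewrite totmapE !totdE totmapE /=.
rewrite totmapE totmapE.
have /= := IHn _ _ _ _ (fun i => u i.+1) z.2 (fun i => hk i.+1) (fun i => vk i.+1).
rewrite totmapE => IH.
case: z IH => x [y1 y2] /= IH; congr (_, _) => //.
by rewrite linearD /= vk addrACA addNr add0r hk.
Qed.

(** Each row contributes its vertical homotopy from [uu] to [u], and the horizontal terms cancel
    because [w] anticommutes with [dh]. *)
Lemma totup_homotopy G (dh : forall i j, 'Hom(G i.+1 j, G i j))
    (dv : forall i j, 'Hom(G i j.+1, G i j))
    (w : forall i j, 'Hom(G i j, G i j.+1))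
    (u uu : forall i j, 'Hom(G i j, G i j)) n z :
    (forall i j x, dh i j.+1 (w i.+1 j x) = - w i j (dh i j x)) ->
    (forall i x, dv i 0%N (w i 0%N x) = u i 0%N x - uu i 0%N x) ->
    (forall i j x, dv i j.+1 (w i j.+1 x) + w i j (dv i j x) =
      u i j.+1 x - uu i j.+1 x) ->
  totd dh dv n.+1 (totup w n.+1 z) + totup w n (totd dh dv n z) =
    totmap u n.+1 z - totmap uu n.+1 z.
Proof.
elim: n G dh dv w u uu z => [|n IHn] G dh dv w u uu z hw vw0 vw.
  rewrite !totmapE totupE totdE; case: z => x y /=.
  rewrite !totup0 addr0 linear0 addr0 vw0.
  by congr (_, _); apply: tot0_eq.
have IH := IHn _ _ _ _ (fun i => u i.+1) (fun i => uu i.+1) z.2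
  (fun i => hw i.+1) (fun i => vw0 i.+1) (fun i => vw i.+1).
rewrite (totmapE u z) (totmapE uu z) (totdE dh dv (totup w n.+2 z)).
rewrite (totupE w (totd dh dv n.+1 z)) (totupE w z) (totdE dh dv z).
case: z IH => x y /= IH.
congr (_, _); last exact: IH.
rewrite totupE /= hw linearD /= addrACA vw.
by rewrite addNr addr0.
Qed.

(** The horizontal part gives [1 - u], the vertical part [u - uu], and the sum telescopes. *)
Lemma tothom_homotopy G (dh : forall i j, 'Hom(G i.+1 j, G i j))
    (dv : forall i j, 'Hom(G i j.+1, G i j))
    (k : forall i j, 'Hom(G i j, G i.+1 j))
    (w : forall i j, 'Hom(G i j, G i j.+1))
    (u uu : forall i j, 'Hom(G i j, G i j)) n z :
    (forall j x, dh 0%N j (k 0%N j x) = x - u 0%N j x) ->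
    (forall i j x, dh i.+1 j (k i.+1 j x) + k i j (dh i j x) = x - u i.+1 j x) ->
    (forall i j x, dv i.+1 j (k i j.+1 x) = - k i j (dv i j x)) ->
    (forall i j x, dh i j.+1 (w i.+1 j x) = - w i j (dh i j x)) ->
    (forall i x, dv i 0%N (w i 0%N x) = u i 0%N x - uu i 0%N x) ->
    (forall i j x, dv i j.+1 (w i j.+1 x) + w i j (dv i j x) =
      u i j.+1 x - uu i j.+1 x) ->
  totd dh dv n.+1 (tothom k w n.+1 z) + tothom k w n (totd dh dv n z) =
    z - totmap uu n.+1 z.
Proof.
move=> hk0 hk vk hw vw0 vw; rewrite !tothomE linearD /= addrACA.
rewrite (totup_homotopy z hw vw0 vw) totdE /= linear0 add0r.
have yE := totmap_homotopy z hk vk.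
case: z yE => x y /= yE.
(* The contribution of [k]: row 0 has only the term [dh k], while the other rows are given by
   [yE]. *)
rewrite [X in X + _](_ : _ = (x - u 0%N n x, y - totmap (fun i => u i.+1) n y)).
  by rewrite !totmapE /=; congr (_, _); rewrite /= addrA subrK.
by congr (_, _); rewrite /= ?addr0 -?yE // totmapE hk0.
Qed.

End TotalComplex.

(** * Tensor products of complexes and the Künneth formula *)

Section TensorDoubleComplex.

Variable K : fieldType.
Implicit Types U V W : vectType K.

Lemma tmap_tmap U V U' V' U2 V2 (f : 'Hom(U, U')) (g : 'Hom(V, V'))
    (f' : 'Hom(U', U2)) (g' : 'Hom(V', V2)) t :
  tmap f' g' (tmap f g t) = tmap (f' \o f)%VF (g' \o g)%VF t.
Proof. by rewrite -comp_lfunE tmap_comp. Qed.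

Lemma tmapDl U V U' V' (f f' : 'Hom(U, U')) (g : 'Hom(V, V')) :
  tmap (f + f') g = tmap f g + tmap f' g.
Proof. by rewrite -!(hom_ofE (proj2 (tmap_bilin U V U' V') g)) linearD. Qed.

Lemma tmapBl U V U' V' (f f' : 'Hom(U, U')) (g : 'Hom(V, V')) :
  tmap (f - f') g = tmap f g - tmap f' g.
Proof. by rewrite -!(hom_ofE (proj2 (tmap_bilin U V U' V') g)) linearB. Qed.

Lemma tmapDr U V U' V' (f : 'Hom(U, U')) (g g' : 'Hom(V, V')) :
  tmap f (g + g') = tmap f g + tmap f g'.
Proof. by rewrite -!(hom_ofE (proj1 (tmap_bilin U V U' V') f)) linearD. Qed.

Lemma tmapBr U V U' V' (f : 'Hom(U, U')) (g g' : 'Hom(V, V')) :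
  tmap f (g - g') = tmap f g - tmap f g'.
Proof. by rewrite -!(hom_ofE (proj1 (tmap_bilin U V U' V') f)) linearB. Qed.

Lemma tmap0l U V U' V' (g : 'Hom(V, V')) : tmap (0 : 'Hom(U, U')) g = 0.
Proof. by rewrite -(hom_ofE (proj2 (tmap_bilin U V U' V') g)) linear0. Qed.

Lemma tmap0r U V U' V' (f : 'Hom(U, U')) : tmap f (0 : 'Hom(V, V')) = 0.
Proof. by rewrite -(hom_ofE (proj1 (tmap_bilin U V U' V') f)) linear0. Qed.

Section Tensor.

Variables (V W : nat -> vectType K).
Variables (d : forall i, 'Hom(V i.+1, V i)) (d' : forall j, 'Hom(W j.+1, W j)).

Definition tens_fam i j : vectType K := tens (V i) (W j).

Definition tens_dh i j : 'Hom(tens_fam i.+1 j, tens_fam i j) := tmap (d i) \1.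
(** The Koszul sign is what makes the two differentials anticommute. *)
Definition tens_dv i j : 'Hom(tens_fam i j.+1, tens_fam i j) :=
  (-1) ^+ i *: tmap \1 (d' j).

Lemma tens_double_complex :
    (forall i, (d i \o d i.+1)%VF = 0) -> (forall j, (d' j \o d' j.+1)%VF = 0) ->
  double_complex tens_dh tens_dv.
Proof.
move=> dd dd'; split=> i j x.
- by rewrite tmap_tmap dd tmap0l zero_lfunE.
- by rewrite !scale_lfunE linearZ /= tmap_tmap dd' tmap0r zero_lfunE !scaler0.
rewrite !scale_lfunE linearZ /= !tmap_tmap !comp_lfun1l !comp_lfun1r exprS mulN1r.
by rewrite scaleNr opprK.
Qed.

End Tensor.

Section Contraction.

Variables (V W : nat -> vectType K).
Variables (d : forall i, 'Hom(V i.+1, V i)) (d' : forall j, 'Hom(W j.+1, W j)).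
Variables (k : forall i, 'Hom(V i, V i.+1)) (u : forall i, 'Hom(V i, V i)).
Variables (k' : forall j, 'Hom(W j, W j.+1)) (u' : forall j, 'Hom(W j, W j)).
Hypotheses (dd : forall i, (d i \o d i.+1)%VF = 0).
Hypotheses (dk0 : (d 0%N \o k 0%N)%VF = \1%VF - u 0%N).
Hypotheses (dk : forall i, ((d i.+1 \o k i.+1) + (k i \o d i))%VF = \1%VF - u i.+1).
Hypotheses (dk0' : (d' 0%N \o k' 0%N)%VF = \1%VF - u' 0%N).
Hypotheses (dk' : forall j,
  ((d' j.+1 \o k' j.+1) + (k' j \o d' j))%VF = \1%VF - u' j.+1).

(** The sign of the vertical part is that of [tens_dv]: the two multiply to 1 in the vertical
    homotopy identity, and the sign makes this part anticommute with [tens_dh]. *)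
Definition tens_hom n :
    'Hom(tot (tens_fam V W) n, tot (tens_fam V W) n.+1) :=
  @tothom K (tens_fam V W) (fun i j => tmap (k i) \1%VF)
    (fun i j => (-1) ^+ i *: tmap (u i) (k' j)) n.

(** Being homotopic to the identity, [u] is a chain map. The vertical part [u ⊗ k'] needs this to
    anticommute with [d ⊗ 1]. *)
Let ud i : (u i \o d i)%VF = (d i \o u i.+1)%VF.
Proof.
have uE j : u j = \1%VF - (\1%VF - u j) by rewrite subKr.
rewrite [u i.+1]uE -dk; case: i => [|i].
  rewrite [u 0%N]uE -dk0 !(comp_lfunDl, comp_lfunDr, comp_lfunNl, comp_lfunNr).
  by rewrite comp_lfun1l comp_lfun1r !comp_lfunA dd comp_lfun0l add0r.
rewrite [u i.+1]uE -dk !(comp_lfunDl, comp_lfunDr, comp_lfunNl, comp_lfunNr).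
rewrite comp_lfun1l comp_lfun1r !comp_lfunA dd comp_lfun0l add0r.
by rewrite -[((_ \o d i) \o _)%VF]comp_lfunA dd comp_lfun0r addr0.
Qed.

Lemma tens_homP n z :
  totd (tens_dh W d) (tens_dv V d') n.+1 (tens_hom n.+1 z)
    + tens_hom n (totd (tens_dh W d) (tens_dv V d') n z) =
  z - totmap (fun i j => tmap (u i) (u' j) : 'End(tens_fam V W i j)) n.+1 z.
Proof.
apply: (tothom_homotopy z (u := fun i j => tmap (u i) \1%VF)) => [j|i j|i j|i j|i|i j] x.
- by rewrite tmap_tmap dk0 comp_lfun1l tmapBl tmap1 add_lfunE opp_lfunE id_lfunE.
- rewrite !tmap_tmap -add_lfunE comp_lfun1l -tmapDl dk tmapBl tmap1.
  by rewrite add_lfunE opp_lfunE id_lfunE.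
- rewrite !scale_lfunE linearZ /= !tmap_tmap !comp_lfun1l !comp_lfun1r exprS mulN1r.
  by rewrite scaleNr.
- rewrite !scale_lfunE linearZ /= !tmap_tmap !comp_lfun1l !comp_lfun1r exprS mulN1r.
  by rewrite scaleNr ud.
- rewrite !scale_lfunE linearZ /= tmap_tmap scalerA -expr2 sqrr_sign scale1r comp_lfun1l.
  by rewrite dk0' tmapBr add_lfunE opp_lfunE.
rewrite !scale_lfunE !linearZ /= !tmap_tmap !scalerA -!expr2 !sqrr_sign !scale1r.
by rewrite comp_lfun1l comp_lfun1r -add_lfunE -tmapDr dk' tmapBr add_lfunE opp_lfunE.
Qed.

End Contraction.

Lemma tens_totmap_totd (V1 W1 V2 W2 : nat -> vectType K)
    (d1 : forall i, 'Hom(V1 i.+1, V1 i)) (e1 : forall j, 'Hom(W1 j.+1, W1 j))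
    (d2 : forall i, 'Hom(V2 i.+1, V2 i))
    (e2 : forall j, 'Hom(W2 j.+1, W2 j)) (f : forall i, 'Hom(V1 i, V2 i))
    (g : forall j, 'Hom(W1 j, W2 j)) n z :
    (forall i, (f i \o d1 i = d2 i \o f i.+1)%VF) ->
    (forall j, (g j \o e1 j = e2 j \o g j.+1)%VF) ->
  totmap (fun i j => tmap (f i) (g j) : 'Hom(tens_fam V1 W1 i j, tens_fam V2 W2 i j)) n
    (totd (tens_dh W1 d1) (tens_dv V1 e1) n z) =
  totd (tens_dh W2 d2) (tens_dv V2 e2) n (totmap (fun i j => tmap (f i) (g j)) n.+1 z).
Proof.
move=> fd ge; apply: totmap_totd => i j x.
  by rewrite !tmap_tmap comp_lfun1l comp_lfun1r fd.
by rewrite !scale_lfunE linearZ /= !tmap_tmap comp_lfun1l comp_lfun1r ge.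
Qed.

(** The retractions onto homology tensor to chain maps [P] and [I] with [P I = 1], and [I P] is
    homotopic to 1 by [tens_homP]. *)
Lemma dim_kunneth (V W : nat -> vectType K) (d : forall i, 'Hom(V i.+1, V i))
    (d' : forall j, 'Hom(W j.+1, W j)) n :
    (forall i, (d i \o d i.+1)%VF = 0) -> (forall j, (d' j \o d' j.+1)%VF = 0) ->
  dim (homology (V := fun m => tot (tens_fam V W) m.+1)
         (fun m => totd (tens_dh W d) (tens_dv V d') m.+1) n) =
  (\sum_(i < n.+1) dim (homology d i) * dim (homology d' (n - i)))%N.
Proof.
move=> dd dd'.
have ddE i x : d i (d i.+1 x) = 0 by rewrite -comp_lfunE dd zero_lfunE.
have ddE' i x : d' i (d' i.+1 x) = 0 by rewrite -comp_lfunE dd' zero_lfunE.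
have [p [i [k [ip pd di dk0 dk]]]] := homology_deformation ddE.
have [p' [i' [k' [ip' pd' di' dk0' dk']]]] := homology_deformation ddE'.
pose H := tens_fam (homology d) (homology d').
(* With zero differentials the total complex of the homologies is its own homology, and its
   dimension is the required sum. *)
pose z1 m : 'Hom(homology d m.+1, homology d m) := 0.
pose z2 m : 'Hom(homology d' m.+1, homology d' m) := 0.
have T0 m x : totd (tens_dh (homology d') z1) (tens_dv (homology d) z2) m x = 0.
  apply: totd0 => r s y; first by rewrite /tens_dh tmap0l zero_lfunE.
  by rewrite /tens_dv tmap0r scaler0 zero_lfunE.
have <- : dim (tot H n.+1) =
    (\sum_(i < n.+1) dim (homology d i) * dim (homology d' (n - i)))%N.
  exact: dim_tot.
have <- : dim (homology (V := fun m => tot H m.+1)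
    (fun m => totd (tens_dh (homology d') z1) (tens_dv (homology d) z2) m.+1) n) =
    dim (tot H n.+1).
  apply: (@dim_homology0 _ (fun m => tot H m.+1)) => m.
  by apply/lfunP=> x; rewrite T0 zero_lfunE.
pose P : forall r s, 'Hom(tens_fam V W r s, H r s) := fun r s => tmap (p r) (p' s).
pose I : forall r s, 'Hom(H r s, tens_fam V W r s) := fun r s => tmap (i r) (i' s).
have PD m x : totmap P m (totd (tens_dh W d) (tens_dv V d') m x) =
    totd (tens_dh (homology d') z1) (tens_dv (homology d) z2) m (totmap P m.+1 x).
  by apply: tens_totmap_totd => r; apply/lfunP=> y;
    rewrite comp_lfun0l zero_lfunE comp_lfunE ?pd ?pd'.
have ID m x : totmap I m
      (totd (tens_dh (homology d') z1) (tens_dv (homology d) z2) m x) =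
    totd (tens_dh W d) (tens_dv V d') m (totmap I m.+1 x).
  by apply: tens_totmap_totd => r; apply/lfunP=> y;
    rewrite comp_lfun0r zero_lfunE comp_lfunE ?di ?di'.
apply/eqP; rewrite eqn_leq; apply/andP; split.
  apply: (homology_retract (f := fun m => totmap P m.+1) (g := fun m => totmap I m.+1)).
  - by move=> m x; apply: PD.
  - by move=> m x; apply: ID.
  move=> x xZ; pose u r := (i r \o p r)%VF; pose u' s := (i' s \o p' s)%VF.
  rewrite (totmap_comp _ (h := fun r s => tmap (u r) (u' s) : 'End(tens_fam V W r s)));
    last by move=> r s y; rewrite tmap_tmap.
  rewrite -(tens_homP (k := k) (d' := d') (k' := k') dd).
  (* In degree 0 there is nothing to show, as the differential takes values in the zero space. *)
  - have Dx : totd (tens_dh W d) (tens_dv V d') n x = 0.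
      by case: n x xZ => [|m] x; [move=> _; apply: tot0_eq | rewrite memv_ker => /eqP].
    by rewrite Dx linear0 addr0 memv_img ?memvf.
  - by apply/lfunP=> y; rewrite comp_lfunE add_lfunE opp_lfunE id_lfunE comp_lfunE dk0.
  - by move=> r; apply/lfunP=> y; rewrite !add_lfunE opp_lfunE id_lfunE !comp_lfunE dk.
  - by apply/lfunP=> y; rewrite comp_lfunE add_lfunE opp_lfunE id_lfunE comp_lfunE dk0'.
  by move=> r; apply/lfunP=> y; rewrite !add_lfunE opp_lfunE id_lfunE !comp_lfunE dk'.
apply: (homology_retract (f := fun m => totmap I m.+1) (g := fun m => totmap P m.+1)).
- by move=> m x; apply: ID.
- by move=> m x; apply: PD.
move=> x _; rewrite (totmap_comp _ (h := fun r s => \1%VF)); last first.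
  move=> r s y; rewrite tmap_tmap id_lfunE.
  rewrite (_ : (_ \o _)%VF = \1%VF) 1?(_ : (p' s \o _)%VF = \1%VF) ?tmap1 ?id_lfunE //;
    by apply/lfunP=> t; rewrite comp_lfunE id_lfunE ?ip ?ip'.
by rewrite totmap_id ?subrr ?mem0v // => r s y; rewrite id_lfunE.
Qed.

End TensorDoubleComplex.

(** * Modules over a tensor product of algebras *)

Section RelativeTensor.

Variables (K : fieldType).

Section Shuffle.

Variables (X M Y N : vectType K).

Definition lpure (U V : vectType K) (u : U) : 'Hom(V, tens U V) :=
  hom_of (proj1 (pure_bilin U V) u).

Definition rpure (U V : vectType K) (v : V) : 'Hom(U, tens U V) :=
  hom_of (proj2 (pure_bilin U V) v).

Lemma lpureE (U V : vectType K) (u : U) (v : V) : lpure V u v = u ⊗ v.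
Proof. exact: hom_ofE. Qed.

Lemma rpureE (U V : vectType K) (u : U) (v : V) : rpure U v u = u ⊗ v.
Proof. exact: hom_ofE. Qed.

Fact lpure_linear (U V : vectType K) : linear (@lpure U V).
Proof.
move=> a u u'; apply/lfunP=> v; rewrite add_lfunE scale_lfunE !lpureE.
exact: (proj2 (pure_bilin U V)).
Qed.

Fact shuffle_bilin :
  bilin (fun (x : X) (m : M) => tmap (lpure Y x) (lpure N m)).
Proof.
have [tr tl] := tmap_bilin Y N (tens X Y) (tens M N).
split=> [x | m] a u v; first by rewrite lpure_linear; apply: tr.
by rewrite lpure_linear; apply: (tl (lpure N m)).
Qed.

Definition shuffle : 'Hom(tens (tens X M) (tens Y N), tens (tens X Y) (tens M N)) :=
  tlift (fun s t => tlift (fun x m => tmap (lpure Y x) (lpure N m)) s t).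

Lemma shuffleE x m y n : shuffle ((x ⊗ m) ⊗ (y ⊗ n)) = (x ⊗ y) ⊗ (m ⊗ n).
Proof.
rewrite /shuffle tliftE; last first.
  by split=> [s|t] a u v; rewrite linearP // add_lfunE scale_lfunE.
by rewrite (tliftE _ _ shuffle_bilin) tmapE !lpureE.
Qed.

End Shuffle.

Lemma eq_tens_tens (U V U' V' W : vectType K)
    (f g : 'Hom(tens (tens U V) (tens U' V'), W)) :
  (forall u v u' v', f ((u ⊗ v) ⊗ (u' ⊗ v')) = g ((u ⊗ v) ⊗ (u' ⊗ v'))) ->
  f = g.
Proof.
move=> fg; apply: eq_tens => s t.
suff /lfunP/(_ s) : (f \o rpure _ t = g \o rpure _ t)%VF.
  by rewrite !comp_lfunE !rpureE.
apply: eq_tens => u v; rewrite !comp_lfunE !rpureE.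
suff /lfunP/(_ t) : (f \o lpure _ (u ⊗ v) = g \o lpure _ (u ⊗ v))%VF.
  by rewrite !comp_lfunE !lpureE.
by apply: eq_tens => u' v'; rewrite !comp_lfunE !lpureE.
Qed.

Section OverTensor.

Variables (A C : falgType K).

Lemma lact_tensE (M : lmodule A) (N : lmodule C) a c m n :
  lact (tens_lmodule M N) (a ⊗ c) (m ⊗ n) = lact M a m ⊗ lact N c n.
Proof. exact: tens_lactE. Qed.

Lemma tensv_full : tensv {:A} {:C} = {:tens A C}%VS.
Proof.
apply/eqP; rewrite eqEsubv subvf; apply/subvP=> t _.
elim/tens_ind: t => [|s t sF tF|a c]; first exact: mem0v.
  exact: rpredD.
by apply: memv_tens; apply: memvf.
Qed.

Lemma act_linear_tens (S : {vspace A}) (T : {vspace C}) (L L' : lmodule (tens A C))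
    (f : 'Hom(L, L')) :
    (forall a c x, a \in S -> c \in T ->
      f (lact L (a ⊗ c) x) = lact L' (a ⊗ c) (f x)) ->
  act_linear (tensv S T) f.
Proof.
move=> fST e eST x.
have gL : linear (fun e => f (lact L e x) - lact L' e (f x)).
  move=> k u v; rewrite !linearP !add_lfunE !scale_lfunE linearP scalerBr opprD.
  by rewrite addrACA.
have : e \in lker (hom_of gL).
  apply: subvP eST; apply: tensv_sub => a c aS cT.
  by rewrite memv_ker hom_ofE fST ?subrr.
by rewrite memv_ker hom_ofE subr_eq0 => /eqP.
Qed.

Lemma act_linear_tens_full (L L' : lmodule (tens A C)) (f : 'Hom(L, L')) :
    (forall a c x, f (lact L (a ⊗ c) x) = lact L' (a ⊗ c) (f x)) ->
  act_linear fullv f.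
Proof. by move=> fAC; rewrite -tensv_full; apply: act_linear_tens => *. Qed.

Lemma tmap_act_linear (S : {vspace A}) (T : {vspace C}) (M M' : lmodule A)
    (N N' : lmodule C) (f : 'Hom(M, M')) (g : 'Hom(N, N')) :
    act_linear S f -> act_linear T g ->
  act_linear (tensv S T)
    (tmap f g : 'Hom(tens_lmodule M N, tens_lmodule M' N')).
Proof.
move=> fS gT; apply: act_linear_tens => a c x aS cT /=.
suff /lfunP/(_ x) : (tmap f g \o tens_lact M N (a ⊗ c) =
    tens_lact M' N' (a ⊗ c) \o tmap f g)%VF.
  by rewrite comp_lfunE => ->; rewrite comp_lfunE.
apply: eq_tens => m n; rewrite !comp_lfunE !(tens_lactE, tmapE).
by rewrite fS ?gT.
Qed.

(** The representative chosen by [qsec] differs from [x ⊗ m] by an element of [balv], and [g]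
    vanishes there. *)
Lemma olift (D : falgType K) (S : {vspace D}) (X : rmodule D) (M : lmodule D)
    (W : vectType K) (g : 'Hom(tens X M, W)) x m :
    (forall b x m, b \in S -> g (ract X b x ⊗ m) = g (x ⊗ lact M b m)) ->
  g (qsec fullv (balv S X M) (opure S x m)) = g (x ⊗ m).
Proof.
move=> gS; apply/eqP; rewrite eq_sym -subr_eq0 -linearB -memv_ker.
have gB : (balv S X M <= lker g)%VS.
  by apply: balv_sub => b y n bS; rewrite memv_ker linearB /= gS ?subrr.
apply: (subvP gB); apply: qsec_qproj.
by apply: subvP (addvSl _ _) _ (memvf _).
Qed.

Section Exchange.

Variables (X : rmodule A) (Y : rmodule C) (P : lmodule A) (Q : lmodule C).
Let PQ := tens_lmodule P Q.

Lemma eq_tens_otens S T (W : vectType K)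
    (f g : 'Hom(tens (otens S X P) (otens T Y Q), W)) :
    (forall x p y q, f (opure S x p ⊗ opure T y q) = g (opure S x p ⊗ opure T y q)) ->
  f = g.
Proof.
move=> fg; apply: eq_tens => u v.
suff /lfunP/(_ u) : (f \o rpure _ v = g \o rpure _ v)%VF.
  by rewrite !comp_lfunE !rpureE.
apply: eq_otens => x p; rewrite !comp_lfunE !rpureE.
suff /lfunP/(_ v) : (f \o lpure _ (opure S x p) = g \o lpure _ (opure S x p))%VF.
  by rewrite !comp_lfunE !lpureE.
by apply: eq_otens => y q; rewrite !comp_lfunE !lpureE.
Qed.

Lemma eq_otens_tens S (W : vectType K)
    (f g : 'Hom(otens S (tens_rmodule X Y) PQ, W)) :
    (forall (x : X) (y : Y) (p : P) (q : Q),
      f (opure S (x ⊗ y : tens_rmodule X Y) (p ⊗ q : PQ)) =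
      g (opure S (x ⊗ y : tens_rmodule X Y) (p ⊗ q : PQ))) ->
  f = g.
Proof.
move=> fg; apply: eq_otens => x m; pose B := balv S (tens_rmodule X Y) PQ.
suff /lfunP/(_ (x ⊗ m)) : (f \o qproj fullv B = g \o qproj fullv B)%VF.
  by rewrite !comp_lfunE.
by apply: eq_tens_tens => {}x y p q; rewrite !comp_lfunE; apply: fg.
Qed.

Section Merge.

Variables (S : {vspace A}) (T : {vspace C}) (ST : {vspace tens A C}).
Variables (Z : rmodule (tens A C)) (j : 'Hom(tens X Y, Z)).
Hypothesis jM : forall a c x y,
  ract Z (a ⊗ c) (j (x ⊗ y)) = j (ract X a x ⊗ ract Y c y).
Hypothesis ST_S : forall a, a \in S -> a ⊗ 1 \in ST.
Hypothesis ST_T : forall c, c \in T -> 1 ⊗ c \in ST.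

Definition merge_pre : 'Hom(tens (tens X P) (tens Y Q), otens ST Z PQ) :=
  (qproj fullv (balv ST Z PQ) \o (tmap j \1 \o shuffle X P Y Q))%VF.

(* j identifies X ⊗ Y with Z, to cover both tens_rmodule X Y and, when X and Y are the
   regular modules, rreg (tens A C). *)
Definition merge : 'Hom(tens (otens S X P) (otens T Y Q), otens ST Z PQ) :=
  (merge_pre \o
   tmap (qsec fullv (balv S X P)) (qsec fullv (balv T Y Q)))%VF.

Lemma merge_preE x p y q :
  merge_pre ((x ⊗ p) ⊗ (y ⊗ q)) = opure ST (j (x ⊗ y)) (p ⊗ q : PQ).
Proof. by rewrite !comp_lfunE shuffleE tmapE id_lfunE. Qed.

(** The chosen representatives are traded for [x ⊗ p] and [y ⊗ q] one factor at a time. With the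
    other factor fixed, moving [b] across [x ⊗ p] means moving [b ⊗ 1] across the target; to make
    [b ⊗ 1] visible, [y] is rewritten as [y 1]. *)
Lemma mergeE x p y q :
  merge (opure S x p ⊗ opure T y q) = opure ST (j (x ⊗ y)) (p ⊗ q : PQ).
Proof.
have rE t t' : (merge_pre \o rpure _ t')%VF t = merge_pre (t ⊗ t').
  by rewrite (comp_lfunE merge_pre) ?lpureE ?rpureE.
have lE t t' : (merge_pre \o lpure _ t)%VF t' = merge_pre (t ⊗ t').
  by rewrite (comp_lfunE merge_pre) ?lpureE ?rpureE.
rewrite (comp_lfunE merge_pre) tmapE -rE olift; last first.
  move=> b {}x {}p bS; rewrite !rE; move: (qsec _ _ _) => t.
  rewrite -!lE; congr (fun_of_lfun _ t).
  apply: eq_tens => {}y {}q; rewrite !lE !merge_preE.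
  rewrite -[y in LHS]id_lfunE -(ract1 Y) -jM opureA ?ST_S //= tens_lactE lact1.
  by rewrite id_lfunE.
rewrite rE -lE olift ?lE ?merge_preE // => c {}y {}q cT; rewrite !lE !merge_preE.
rewrite -[x in LHS]id_lfunE -(ract1 X) -jM opureA ?ST_T //= tens_lactE lact1.
by rewrite id_lfunE.
Qed.

End Merge.

Definition otens_split :
    'Hom(otens fullv (tens_rmodule X Y) PQ, tens (otens fullv X P) (otens fullv Y Q)) :=
  ((tmap (qproj fullv (balv fullv X P)) (qproj fullv (balv fullv Y Q)) \o
    shuffle X Y P Q) \o qsec fullv (balv fullv (tens_rmodule X Y) PQ))%VF.

Lemma otens_splitE (x : X) (y : Y) (p : P) (q : Q) :
  otens_split (opure fullv (x ⊗ y : tens_rmodule X Y) (p ⊗ q : PQ)) =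
    opure fullv x p ⊗ opure fullv y q.
Proof.
rewrite /otens_split; set g := (tmap _ _ \o shuffle X Y P Q)%VF.
have gE x' y' p' q' : g ((x' ⊗ y') ⊗ (p' ⊗ q')) = opure fullv x' p' ⊗ opure fullv y' q'.
  by rewrite comp_lfunE shuffleE tmapE.
rewrite (comp_lfunE g) -gE.
apply: (@olift _ fullv (tens_rmodule X Y) PQ) => b {}x m _.
(* Here [b] is any element of [A ⊗ C]. Phrased with [bal], the claim is additive in [b], which
   reduces it to pure tensors. *)
suff gbal : (g \o bal (tens_rmodule X Y) PQ b)%VF = 0.
  apply/eqP; rewrite -subr_eq0 -linearB -(balE (X := tens_rmodule X Y) (M := PQ)).
  by apply/eqP; move/lfunP/(_ (x ⊗ m)): gbal; rewrite zero_lfunE (comp_lfunE g).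
elim/tens_ind: b => [|b b' IHb IHb'|a c].
- by rewrite /bal !linear0 tmap0l tmap0r subr0 comp_lfun0r.
- rewrite /bal !linearD /= tmapDl tmapDr opprD addrACA comp_lfunDr.
  by rewrite [X in X + _]IHb [X in _ + X]IHb' addr0.
apply: eq_tens_tens => x' y' p' q'; rewrite (comp_lfunE g) zero_lfunE.
rewrite (balE (X := tens_rmodule X Y) (M := PQ)) linearB /= tens_ractE tens_lactE.
by rewrite !gE !opureA ?memvf ?subrr.
Qed.

Lemma otens_split_bij : bijective otens_split.
Proof.
have jM a c (x : X) (y : Y) :
    ract (tens_rmodule X Y) (a ⊗ c) ((\1%VF : 'End(tens X Y)) (x ⊗ y)) =
    (\1%VF : 'End(tens X Y)) (ract X a x ⊗ ract Y c y).
  by rewrite !id_lfunE [LHS]tens_ractE.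
pose m := merge fullv fullv fullv (\1%VF : 'Hom(tens X Y, tens_rmodule X Y)).
have mE x p y q : m (opure fullv x p ⊗ opure fullv y q) =
    opure fullv (x ⊗ y : tens_rmodule X Y) (p ⊗ q : PQ).
  by rewrite mergeE ?id_lfunE // => *; apply: memvf.
exists m => t.
  suff /lfunP/(_ t) : (m \o otens_split)%VF = \1%VF by rewrite comp_lfunE id_lfunE.
  by apply: eq_otens_tens => x y p q; rewrite comp_lfunE otens_splitE mE id_lfunE.
suff /lfunP/(_ t) : (otens_split \o m)%VF = \1%VF by rewrite comp_lfunE id_lfunE.
by apply: eq_tens_otens => x p y q; rewrite comp_lfunE mE otens_splitE id_lfunE.
Qed.

End Exchange.

(** The multiplication map composed with [merge] is the tensor product of the two multiplication
    maps, so [merge] after [sP ⊗ sQ] is a splitting. Well-definedness and linearity of [merge]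
    suffice for this. *)
Lemma rel_projective_tens (B : {vspace A}) (D : {vspace C}) (P : lmodule A)
    (Q : lmodule C) : 1 \in B -> 1 \in D ->
    rel_projective B P -> rel_projective D Q ->
  rel_projective (tensv B D) (tens_lmodule P Q).
Proof.
move=> B1 D1 [sP sPA sPK] [sQ sQC sQK].
pose j : 'Hom(tens (rreg A) (rreg C), rreg (tens A C)) := \1%VF.
have jM a c (x : rreg A) (y : rreg C) :
    ract (rreg (tens A C)) (a ⊗ c) (j (x ⊗ y)) =
    j (ract (rreg A) a x ⊗ ract (rreg C) c y).
  by rewrite !id_lfunE !rregE; apply: pureM.
pose BD := tensv B D; pose PQ := tens_lmodule P Q.
pose m : 'Hom(tens_lmodule (ind B P) (ind D Q), ind BD PQ) := merge P Q B D BD j.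
have mE x p y q : m (opure B x p ⊗ opure D y q) =
    opure BD (x ⊗ y : rreg (tens A C)) (p ⊗ q : PQ).
  (* Unitality of [B] and [D] places [a ⊗ 1] and [1 ⊗ c] in [B ⊗ D]. *)
  rewrite [LHS]mergeE ?id_lfunE // => [a aB|c cD]; exact: memv_tens.
have mA : act_linear fullv m.
  apply: act_linear_tens_full => a c t.
  suff /lfunP/(_ t) : (m \o lact (tens_lmodule (ind B P) (ind D Q)) (a ⊗ c) =
      lact (ind BD PQ) (a ⊗ c) \o m)%VF.
    by rewrite (comp_lfunE m) (comp_lfunE (lact _ _)).
  apply: eq_tens_otens => x p y q; rewrite (comp_lfunE m) (comp_lfunE (lact _ _)).
  rewrite mE.
  have -> : lact (tens_lmodule (ind B P) (ind D Q)) (a ⊗ c)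
        (opure B x p ⊗ opure D y q) =
      lact (ind B P) a (opure B x p) ⊗ lact (ind D Q) c (opure D y q).
    exact: lact_tensE.
  rewrite !ind_lactE [LHS]mE.
  by rewrite -pureM.
pose s : 'Hom(PQ, ind BD PQ) := (m \o tmap sP sQ)%VF.
exists s.
  apply: act_linear_comp => //.
  by rewrite -tensv_full; apply: tmap_act_linear.
rewrite /s comp_lfunA.
have -> : (mulmap BD PQ \o m = tmap (mulmap B P) (mulmap D Q))%VF.
  apply: eq_tens_otens => x p y q; rewrite comp_lfunE mE tmapE !mulmapE.
  exact: tens_lactE.
by rewrite tmap_comp sPK sQK tmap1.
Qed.

End OverTensor.

End RelativeTensor.

(** * Total complexes of modules *)

Section TotalModule.

Variables (K : fieldType) (A : falgType K).
Implicit Types (G : nat -> nat -> lmodule A) (S B : {vspace A}) (L M N : lmodule A).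

Section Module.

Variables (G : nat -> nat -> lmodule A) (n : nat).

Definition totact_fun (a : A) : 'End(tot G n) := totmap (fun i j => lact (G i j) a) n.

Fact totact_linear : linear totact_fun.
Proof.
move=> k a b; apply/lfunP=> z; rewrite add_lfunE scale_lfunE /totact_fun.
elim: n G z => [|m IHm] H z; first exact: tot0_eq.
by rewrite !totmapE IHm linearP add_lfunE scale_lfunE.
Qed.

Definition totact := hom_of totact_linear.

Lemma totactE a z : totact a z = totmap (fun i j => lact (G i j) a) n z.
Proof. by rewrite /totact hom_ofE. Qed.

Fact totact1 : totact 1 = \1%VF.
Proof.
apply/lfunP=> z; rewrite totactE id_lfunE.
by apply: totmap_id => i j x; rewrite lact1 id_lfunE.
Qed.

Fact totactM a b : totact (a * b) = (totact a \o totact b)%VF.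
Proof.
apply/lfunP=> z; rewrite comp_lfunE !totactE; apply/esym/totmap_comp=> i j x.
by rewrite lactM comp_lfunE.
Qed.

Definition totmod : lmodule A := LModule totact1 totactM.

Lemma lact_totE a (z : totmod) : lact totmod a z = totmap (fun i j => lact (G i j) a) n z.
Proof. exact: totactE. Qed.

End Module.

Lemma lact_totSE G n a (z : totmod G n.+1) :
  lact (totmod G n.+1) a z =
    (lact (G 0%N n) a z.1, lact (totmod (fun i => G i.+1) n) a z.2).
Proof. by rewrite !lact_totE totmapE. Qed.

Lemma totmap_act_linear S G G' (f : forall i j, 'Hom(G i j, G' i j)) n :
    (forall i j, act_linear S (f i j)) ->
  act_linear S (totmap f n : 'Hom(totmod G n, totmod G' n)).
Proof.
move=> fS a aS z; rewrite !lact_totE.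
rewrite (totmap_comp _ (h := fun i j => (f i j \o lact (G i j) a)%VF)); last first.
  by move=> i j x; rewrite comp_lfunE.
apply/esym/totmap_comp=> i j x.
by rewrite comp_lfunE fS.
Qed.

Lemma totup_act_linear S G (w : forall i j, 'Hom(G i j, G i j.+1)) n :
    (forall i j, act_linear S (w i j)) ->
  act_linear S (totup w n : 'Hom(totmod G n, totmod G n.+1)).
Proof.
move=> wS a aS z; rewrite !lact_totE.
elim: n G w wS z => [|n IHn] G w wS z; first by rewrite !totup0 linear0.
by rewrite totupE !totmapE totupE /= wS // (IHn _ (fun i => w i.+1)) // totmapE.
Qed.

Lemma totd_act_linear S G (dh : forall i j, 'Hom(G i.+1 j, G i j))
    (dv : forall i j, 'Hom(G i j.+1, G i j)) n :
    (forall i j, act_linear S (dh i j)) -> (forall i j, act_linear S (dv i j)) ->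
  act_linear S (totd dh dv n : 'Hom(totmod G n.+1, totmod G n)).
Proof.
move=> hS vS a aS z; rewrite !lact_totE; apply/esym/totmap_totd=> i j x.
  by rewrite hS.
by rewrite vS.
Qed.

Lemma tothom_act_linear S G (k : forall i j, 'Hom(G i j, G i.+1 j))
    (w : forall i j, 'Hom(G i j, G i j.+1)) n :
    (forall i j, act_linear S (k i j)) -> (forall i j, act_linear S (w i j)) ->
  act_linear S (tothom k w n : 'Hom(totmod G n, totmod G n.+1)).
Proof.
move=> kS wS a aS z; rewrite !tothomE linearD /= (totup_act_linear wS aS).
congr (_ + _); apply/esym/(etrans (lact_totSE _ _)); rewrite linear0; congr (_, _).
apply/esym.
exact: (totmap_act_linear (G' := fun i => G i.+1) (n := n) kS aS z).
Qed.

Lemma mulmap_omap B L M (f : 'Hom(L, M)) y : act_linear fullv f ->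
  mulmap B M (omap B (rreg A) f y) = f (mulmap B L y).
Proof.
move=> fA; set F : 'Hom(ind B L, ind B M) := omap B (rreg A) f.
suff /lfunP/(_ y) : (mulmap B M \o F = f \o mulmap B L)%VF.
  by rewrite (comp_lfunE (mulmap B M)) (comp_lfunE f).
apply: eq_otens => a m; rewrite (comp_lfunE (mulmap B M)) (comp_lfunE f).
by rewrite /F omapE ?mulmapE ?fA ?memvf //; apply: act_linear_full.
Qed.

(** A direct sum is presented by its inclusions and projections, because [totmod] carries an action
    defined by its own recursion. *)
Lemma rel_projective_sum B L M N (i : 'Hom(M, L)) (p : 'Hom(L, M)) (i' : 'Hom(N, L))
    (p' : 'Hom(L, N)) :
    act_linear fullv i -> act_linear fullv p -> act_linear fullv i' ->
    act_linear fullv p' -> (forall x, i (p x) + i' (p' x) = x) ->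
    rel_projective B M -> rel_projective B N ->
  rel_projective B L.
Proof.
move=> iA pA iA' pA' ip [s sA sK] [s' sA' sK'].
pose I : 'Hom(ind B M, ind B L) := omap B (rreg A) i.
pose I' : 'Hom(ind B N, ind B L) := omap B (rreg A) i'.
exists ((I \o (s \o p)) + (I' \o (s' \o p')))%VF.
  by apply: act_linearD; apply: act_linear_comp;
    [apply/omap_act_linear/act_linear_full | apply: act_linear_comp
    |apply/omap_act_linear/act_linear_full | apply: act_linear_comp].
apply/lfunP=> x; rewrite comp_lfunE add_lfunE (comp_lfunE I) (comp_lfunE I') linearD /=.
rewrite !mulmap_omap // (comp_lfunE s) (comp_lfunE s') id_lfunE -[RHS]ip.
have /lfunP/(_ (p x)) := sK; have /lfunP/(_ (p' x)) := sK'.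
by rewrite !comp_lfunE !id_lfunE => -> ->.
Qed.

Lemma rel_projective_tot B G n :
  (forall i j, rel_projective B (G i j)) -> rel_projective B (totmod G n).
Proof.
elim: n G => [|n IHn] G GB.
  exists 0; first exact: act_linear0.
  by apply/lfunP=> z; apply: tot0_eq.
pose H := totmod (fun i => G i.+1) n.
have lE a z : lact (totmod G n.+1) a z = (lact (G 0%N n) a z.1, lact H a z.2).
  exact: lact_totSE.
apply: (@rel_projective_sum B (totmod G n.+1) (G 0%N n) H
  (lpair \1%VF 0) (lfst _ _) (lpair 0 \1%VF) (lsnd _ _)) => //.
- by move=> a _ x; rewrite lE !lpairE !id_lfunE !zero_lfunE linear0.
- by move=> a _ x; rewrite lE !lfstE.
- by move=> a _ x; rewrite lE !lpairE !id_lfunE !zero_lfunE linear0.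
- by move=> a _ x; rewrite lE !lsndE.
- case=> x y; rewrite !lpairE lfstE lsndE !id_lfunE !zero_lfunE.
  by congr (_, _); rewrite /= ?addr0 ?add0r.
exact: IHn.
Qed.

Section TensorTotal.

Variables (S : {vspace A}) (Z : rmodule A).

Definition otens_fam G i j : vectType K := otens S Z (G i j).

Lemma otens_tot0_eq G (u v : otens S Z (totmod G 0)) : u = v.
Proof.
suff H : (\1%VF : 'End(otens S Z (totmod G 0))) = 0.
  by rewrite -[u]id_lfunE -[v]id_lfunE H !zero_lfunE.
apply: eq_otens => z x; rewrite id_lfunE zero_lfunE (tot0_eq x 0).
by rewrite -(hom_ofE (proj1 (opure_bilin S Z (totmod G 0)) z)) linear0.
Qed.

Fixpoint otens_tot G n : 'Hom(otens S Z (totmod G n), tot (otens_fam G) n) :=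
  if n is m.+1 return 'Hom(otens S Z (totmod G n), tot (otens_fam G) n) then
    lpair (omap S Z (lfst _ _ : 'Hom(totmod G m.+1, G 0%N m)))
      (otens_tot (fun i => G i.+1) m \o
        omap S Z (lsnd _ _ : 'Hom(totmod G m.+1, totmod (fun i => G i.+1) m)))%VF
  else 0.

#[global] Arguments otens_tot : simpl never.

Lemma lfst_act_linear G n :
  act_linear S (lfst _ _ : 'Hom(totmod G n.+1, G 0%N n)).
Proof. by move=> a _ z; rewrite lact_totSE !lfstE. Qed.

Lemma lsnd_act_linear G n :
  act_linear S (lsnd _ _ : 'Hom(totmod G n.+1, totmod (fun i => G i.+1) n)).
Proof. by move=> a _ z; rewrite lact_totSE !lsndE. Qed.

Lemma linl_act_linear G n :
  act_linear S (lpair \1%VF 0 : 'Hom(G 0%N n, totmod G n.+1)).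
Proof.
move=> a _ z; rewrite [RHS]lact_totSE !lpairE !id_lfunE !zero_lfunE.
by rewrite linear0.
Qed.

Lemma linr_act_linear G n :
  act_linear S (lpair 0 \1%VF : 'Hom(totmod (fun i => G i.+1) n, totmod G n.+1)).
Proof.
move=> a _ z; rewrite [RHS]lact_totSE !lpairE !id_lfunE !zero_lfunE.
by rewrite linear0.
Qed.

Lemma otens_totE G n (z : Z) (x : G 0%N n) (y : totmod (fun i => G i.+1) n) :
  otens_tot G n.+1 (opure S z ((x, y) : totmod G n.+1)) =
    (opure S z x, otens_tot (fun i => G i.+1) n (opure S z y)).
Proof.
rewrite [LHS]lpairE comp_lfunE omapE; last exact: lsnd_act_linear.
rewrite omapE; last exact: lfst_act_linear.
by rewrite lfstE lsndE.
Qed.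

Lemma otens_tot_bij G n : bijective (otens_tot G n).
Proof.
elim: n G => [|n IHn] G.
  by exists (fun=> 0) => t; [apply: otens_tot0_eq | apply: tot0_eq].
(* The induction hypothesis yields a bare inverse function; a linear one is needed to form [h]. *)
have := lfun_bijK (IHn (fun i => G i.+1)).
set g := (otens_tot _ n)^-1%VF => -[gK Kg].
pose il : 'Hom(otens S Z (G 0%N n), otens S Z (totmod G n.+1)) :=
  omap S Z (lpair \1%VF 0 : 'Hom(G 0%N n, totmod G n.+1)).
pose ir : 'Hom(otens S Z (totmod (fun i => G i.+1) n), otens S Z (totmod G n.+1)) :=
  omap S Z (lpair 0 \1%VF : 'Hom(totmod (fun i => G i.+1) n, totmod G n.+1)).
pose h : 'Hom(tot (otens_fam G) n.+1, otens S Z (totmod G n.+1)) :=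
  ((il \o lfst _ _) + (ir \o (g \o lsnd _ _)))%VF.
have hE u v : h (u, v) = il u + ir (g v).
  by rewrite add_lfunE (comp_lfunE il) (comp_lfunE ir) comp_lfunE lfstE lsndE.
exists h => t.
  suff /lfunP/(_ t) : (h \o otens_tot G n.+1)%VF = \1%VF.
    by rewrite (comp_lfunE h) id_lfunE.
  apply: eq_otens => z [x y]; rewrite (comp_lfunE h) otens_totE hE gK id_lfunE.
  rewrite /il /ir !omapE ?lpairE ?id_lfunE ?zero_lfunE; last 2 first.
  - exact: linr_act_linear.
  - exact: linl_act_linear.
  rewrite -!(hom_ofE (proj1 (opure_bilin S Z (totmod G n.+1)) z)) -linearD.
  by congr (hom_of _ (_, _)); rewrite /= ?addr0 ?add0r.
case: t => u v; rewrite hE linearD /=.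
have lE : (otens_tot G n.+1 \o il)%VF = lpair \1%VF 0.
  apply: eq_otens => z x; rewrite comp_lfunE /il omapE; last exact: linl_act_linear.
  rewrite (lpairE \1%VF 0) id_lfunE zero_lfunE otens_totE lpairE id_lfunE zero_lfunE.
  rewrite -(hom_ofE (proj1 (opure_bilin S Z (totmod (fun i => G i.+1) n)) z)).
  by rewrite !linear0.
have rE : (otens_tot G n.+1 \o ir)%VF = lpair 0 (otens_tot (fun i => G i.+1) n).
  apply: eq_otens => z x; rewrite comp_lfunE /ir omapE; last exact: linr_act_linear.
  rewrite (lpairE 0 \1%VF) zero_lfunE id_lfunE otens_totE lpairE zero_lfunE.
  by rewrite -(hom_ofE (proj1 (opure_bilin S Z (G 0%N n)) z)) linear0.
move/lfunP/(_ u): lE; move/lfunP/(_ (g v)): rE; rewrite !comp_lfunE => -> ->.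
rewrite !lpairE Kg id_lfunE !zero_lfunE.
by congr (_, _); rewrite /= ?addr0 ?add0r.
Qed.

Lemma otens_tot_totd G (dh : forall i j, 'Hom(G i.+1 j, G i j))
    (dv : forall i j, 'Hom(G i j.+1, G i j)) n t :
    (forall i j, act_linear S (dh i j)) -> (forall i j, act_linear S (dv i j)) ->
  otens_tot G n (omap S Z (totd dh dv n : 'Hom(totmod G n.+1, totmod G n)) t) =
    totd (fun i j => omap S Z (dh i j) : 'Hom(otens_fam G i.+1 j, otens_fam G i j))
      (fun i j => omap S Z (dv i j) : 'Hom(otens_fam G i j.+1, otens_fam G i j)) n
      (otens_tot G n.+1 t).
Proof.
move=> hS vS; pose D n : 'Hom(totmod G n.+1, totmod G n) := totd dh dv n.
pose D' n := totd (fun i j => omap S Z (dh i j) : 'Hom(otens_fam G i.+1 j, otens_fam G i j))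
  (fun i j => omap S Z (dv i j) : 'Hom(otens_fam G i j.+1, otens_fam G i j)) n.
have DS m : act_linear S (D m) by apply: totd_act_linear.
suff /lfunP/(_ t) : (otens_tot G n \o omap S Z (D n) = D' n \o otens_tot G n.+1)%VF.
  by rewrite (comp_lfunE (otens_tot G n)) (comp_lfunE (D' n)).
apply: eq_otens => z x; rewrite (comp_lfunE (otens_tot G n)) (comp_lfunE (D' n)) omapE //.
rewrite /D /D' {D D' DS t}.
elim: n G dh dv hS vS x => [|n IHn] G dh dv hS vS x; first exact: tot0_eq.
case: x => [x [y1 y2]]; have -> := totdE dh dv ((x, (y1, y2)) : tot G n.+2).
rewrite [LHS]otens_totE /= otens_totE totdE /=.
congr (_, _); last by rewrite /= (IHn _ _ _ (fun i => hS i.+1) (fun i => vS i.+1)).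
rewrite otens_totE /= !omapE //.
by rewrite -!(hom_ofE (proj1 (opure_bilin S Z (G 0%N n)) z)) linearD.
Qed.

End TensorTotal.

End TotalModule.

(** * The total complex as a resolution of [M ⊗ N] *)

Section TensorResolution.

Variables (K : fieldType) (A C : falgType K) (B : {aspace A}) (D : {aspace C}).
Hypotheses (B1 : 1 \in B) (D1 : 1 \in D).
Variables (M : lmodule A) (N : lmodule C).
Variables (P : rel_resolution B M) (Q : rel_resolution D N).

Definition tens_mod i j : lmodule (tens A C) := tens_lmodule (P i) (Q j).

Let dh i j : 'Hom(tens_mod i.+1 j, tens_mod i j) := tens_dh (fun j => Q j) (diff P) i j.
Let dv i j : 'Hom(tens_mod i j.+1, tens_mod i j) := tens_dv (fun i => P i) (diff Q) i j.

Lemma tens_dh_act_linear i j : act_linear fullv (dh i j).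
Proof.
rewrite -tensv_full; apply: tmap_act_linear; first exact: diff_linear.
exact: act_linear1.
Qed.

Lemma tens_dv_act_linear i j : act_linear fullv (dv i j).
Proof.
apply: act_linearZ; rewrite -tensv_full; apply: tmap_act_linear.
  exact: act_linear1.
exact: diff_linear.
Qed.

Definition total_obj n : lmodule (tens A C) := totmod tens_mod n.+1.

Definition total_diff n : 'Hom(total_obj n.+1, total_obj n) := totd dh dv n.+1.

Fact total_diff_linear n : act_linear fullv (total_diff n).
Proof.
by apply: totd_act_linear => i j; [apply: tens_dh_act_linear | apply: tens_dv_act_linear].
Qed.

Fact total_diff_comp n : (total_diff n \o total_diff n.+1)%VF = 0.
Proof.
apply/lfunP=> z; rewrite comp_lfunE zero_lfunE; apply: totdK.
by apply: tens_double_complex => i; apply: diff_comp.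
Qed.

Definition total_complex : complex (tens A C) :=
  Complex total_diff_linear total_diff_comp.

Definition total_aug : 'Hom(total_obj 0, tens_lmodule M N) :=
  (tmap (aug P) (aug Q) \o lfst _ _)%VF.

Lemma total_augE z : total_aug z = tmap (aug P) (aug Q) z.1.
Proof. by rewrite comp_lfunE lfstE. Qed.

Fact total_aug_linear : act_linear fullv total_aug.
Proof.
move=> a aAC z; rewrite !total_augE lact_totSE /=.
have eAC : act_linear (tensv {:A} {:C})
    (tmap (aug P) (aug Q) : 'Hom(tens_mod 0%N 0%N, tens_lmodule M N)).
  by apply: tmap_act_linear; apply: aug_lin.
by apply: eAC; rewrite tensv_full.
Qed.

Fact total_aug_diff0 : (total_aug \o diff total_complex 0)%VF = 0.
Proof.
apply/lfunP=> z; rewrite comp_lfunE zero_lfunE total_augE [diff _ _]/= totdE /=.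
rewrite linearD /= /dv /dh /tens_dv /tens_dh expr0 scale1r !tmap_tmap !aug_diff0.
by rewrite tmap0l tmap0r !zero_lfunE addr0.
Qed.

(** A contraction of the augmented complex is a [B]-linear deformation retraction of [P] onto [M]
    placed in degree 0: [h 0] is the section of [aug] and the later [h] form the homotopy. Thus
    [tens_homP] applies. *)
Lemma total_exact : rel_exact (tensv_aspace B D)
  (augment (P := total_complex) total_aug_linear total_aug_diff0).
Proof.
have [h [hB h0 hS]] := res_exact P; have [h' [hD h0' hS']] := res_exact Q.
pose k i : 'Hom(P i, P i.+1) := h i.+1; pose k' j : 'Hom(Q j, Q j.+1) := h' j.+1.
pose eta : 'Hom(M, P 0%N) := h 0%N; pose eta' : 'Hom(N, Q 0%N) := h' 0%N.
(* The retraction [eta aug] lives in degree 0 only, as [M] does. *)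
pose u i : 'End(P i) := if i is 0%N return 'End(P i) then (eta \o aug P)%VF else 0.
pose u' j : 'End(Q j) := if j is 0%N return 'End(Q j) then (eta' \o aug Q)%VF else 0.
have dk0 : (diff P 0 \o k 0%N)%VF = \1%VF - u 0%N by rewrite -(hS 0%N) addrK.
have dk0' : (diff Q 0 \o k' 0%N)%VF = \1%VF - u' 0%N by rewrite -(hS' 0%N) addrK.
have dk i : ((diff P i.+1 \o k i.+1) + (k i \o diff P i))%VF = \1%VF - u i.+1.
  by rewrite subr0 -(hS i.+1).
have dk' j : ((diff Q j.+1 \o k' j.+1) + (k' j \o diff Q j))%VF = \1%VF - u' j.+1.
  by rewrite subr0 -(hS' j.+1).
have H := tens_homP (diff_comp P) dk0 dk dk0' dk'.
pose s0 : 'Hom(tens_lmodule M N, total_obj 0) := lpair (tmap eta eta') 0.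
have s0E x : s0 x = (tmap eta eta' x, 0) by rewrite lpairE zero_lfunE.
pose s n : 'Hom(aug_obj total_complex (tens_lmodule M N) n,
    aug_obj total_complex (tens_lmodule M N) n.+1) :=
  if n is m.+1 return 'Hom(aug_obj total_complex (tens_lmodule M N) n,
    aug_obj total_complex (tens_lmodule M N) n.+1)
  then tens_hom k u k' m.+1 else s0.
have uB i : act_linear B (u i).
  case: i => [|i]; last exact: act_linear0.
  apply: act_linear_comp; first exact: (hB 0%N).
  by apply: act_linear_full; apply: aug_lin.
exists s; split=> [[|n]||[|n]].
- move=> a aBD x; rewrite -[s 0%N]/s0 !s0E.
  apply/esym/(etrans (lact_totSE _ _)); rewrite linear0; congr (_, _); apply/esym.
  have eBD : act_linear (tensv B D)
      (tmap eta eta' : 'Hom(tens_lmodule M N, tens_mod 0%N 0%N)).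
    by apply: tmap_act_linear; [apply: (hB 0%N) | apply: (hD 0%N)].
  exact: eBD.
- apply: (tothom_act_linear (G := tens_mod)) => i j.
    by apply: tmap_act_linear; [apply: (hB i.+1) | apply: act_linear1].
  by apply: act_linearZ; apply: tmap_act_linear => //; apply: (hD j.+1).
- apply/lfunP=> x; rewrite (comp_lfunE total_aug) total_augE s0E tmap_tmap.
  by rewrite h0 h0' tmap1 !id_lfunE.
- apply/lfunP=> z; rewrite add_lfunE id_lfunE (comp_lfunE s0) (comp_lfunE (total_diff 0)).
  (* In degree 0 the term [u ⊗ u'] is [s0] after the augmentation. *)
  have -> : total_diff 0 (s 1%N z) = z - s0 (total_aug z).
    have := H 0%N z.
    rewrite (tot0_eq (totd _ _ 0%N z) 0) linear0 addr0 => ->.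
    rewrite s0E total_augE tmap_tmap totmapE; congr (_ - (_, _)); exact: tot0_eq.
  by rewrite subrK.
apply/lfunP=> z; rewrite add_lfunE id_lfunE (comp_lfunE (total_diff n.+1)).
rewrite (comp_lfunE (s n.+1)); apply: (etrans (H n.+1 z)).
(* In positive total degree one of the two indices is positive, so [u ⊗ u'] vanishes: through [u']
   in row 0, through [u] in the other rows. *)
rewrite totmapE tmap0r zero_lfunE totmap_eq0 => [|i j]; last exact: tmap0l.
exact: subr0.
Qed.

Definition total_resolution : rel_resolution (tensv_aspace B D) (tens_lmodule M N) :=
  @RelResolution K (tens A C) (tensv_aspace B D) (tens_lmodule M N) total_complex
    total_aug total_aug_linear total_aug_diff0
    (fun n => rel_projective_tot n.+1 (fun i j =>
       rel_projective_tens B1 D1 (res_proj P i) (res_proj Q j)))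
    total_exact.

End TensorResolution.

(** * Identification of the complexes and conclusion *)

Section TensorHomology.

Variables (K : fieldType) (A C : falgType K) (X : rmodule A) (Y : rmodule C).

(** Naturality of the exchange isomorphism; the scalar [c] carries the Koszul sign, so that one
    statement serves both differentials. *)
Lemma otens_split_tmap (L L' : lmodule A) (N N' : lmodule C) (f : 'Hom(L, L'))
    (g : 'Hom(N, N')) (h : 'Hom(tens_lmodule L N, tens_lmodule L' N')) (c : K) t :
    act_linear fullv f -> act_linear fullv g -> h = c *: tmap f g ->
  otens_split X Y L' N' (omap fullv (tens_rmodule X Y) h t) =
    (c *: tmap (omap fullv X f) (omap fullv Y g)) (otens_split X Y L N t).
Proof.
move=> fA gC ->; set Z := tens_rmodule X Y.
pose H : 'Hom(tens_lmodule L N, tens_lmodule L' N') := c *: tmap f g.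
have HA : act_linear fullv H.
  by apply: act_linearZ; rewrite -tensv_full; apply: tmap_act_linear.
pose F := otens_split X Y L' N'; pose F' := otens_split X Y L N.
pose T := c *: tmap (omap fullv X f) (omap fullv Y g).
suff /lfunP/(_ t) : (F \o omap fullv Z H = T \o F')%VF.
  by rewrite (comp_lfunE F) (comp_lfunE T).
apply: eq_otens_tens => x y p q; rewrite (comp_lfunE F) (comp_lfunE T) omapE //.
have -> : H (p ⊗ q) = c *: (f p ⊗ g q) by rewrite scale_lfunE tmapE.
rewrite [F' _]otens_splitE scale_lfunE tmapE !omapE //.
rewrite (bilinZr (opure_bilin fullv Z (tens_lmodule L' N'))) linearZ /=.
by congr (_ *: _); apply: otens_splitE.
Qed.

End TensorHomology.

Lemma dim_dsum (K : fieldType) (F : nat -> vectType K) n :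
  dim (dsum F n) = (\sum_(s < n.+1) dim (F s))%N.
Proof.
elim: n => [|n IHn]; first by rewrite big_ord1.
by rewrite big_ord_recr /= -IHn.
Qed.

Theorem theorem4p7 (K : fieldType) (perfK : perfect_field K)
    (charK : 2%N \notin [pchar K]) (A C : falgType K)
    (B : {aspace A}) (D : {aspace C}) (B1 : 1 \in B) (D1 : 1 \in D)
    (M : lmodule A) (X : rmodule A) (N : lmodule C) (Y : rmodule C)
    (P : rel_resolution B M) (Q : rel_resolution D N)
    (R : rel_resolution (tensv_aspace B D) (tens_lmodule M N))
    (n : nat) :
  isomorphic (Tor (tens_rmodule X Y) R n)
    (dsum (fun s => tens (Tor X P s) (Tor Y Q (n - s))) n).
Proof.
apply: eq_dim_isomorphic.
rewrite (eq_dim_Tor _ R (total_resolution B1 D1 P Q)) dim_dsum.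
pose Z := tens_rmodule X Y; pose G := tens_mod P Q.
pose d i : 'Hom(otens fullv X (P i.+1), otens fullv X (P i)) := omap fullv X (diff P i).
pose e j : 'Hom(otens fullv Y (Q j.+1), otens fullv Y (Q j)) := omap fullv Y (diff Q j).
have dd i : (d i \o d i.+1)%VF = 0.
  apply/lfunP=> t; rewrite comp_lfunE zero_lfunE omap_comp; try exact: diff_linear.
  by rewrite diff_comp omap0 zero_lfunE.
have ee j : (e j \o e j.+1)%VF = 0.
  apply/lfunP=> t; rewrite comp_lfunE zero_lfunE omap_comp; try exact: diff_linear.
  by rewrite diff_comp omap0 zero_lfunE.
(* The dimension of [tens] is by conversion the product of the dimensions, so the sum is already the
   Künneth one. *)
rewrite -[RHS](dim_kunneth n dd ee).
pose dh i j : 'Hom(G i.+1 j, G i j) := tens_dh (fun j => Q j) (diff P) i j.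
pose dv i j : 'Hom(G i j.+1, G i j) := tens_dv (fun i => P i) (diff Q) i j.
pose XY := tens_fam (fun i => otens fullv X (P i)) (fun j => otens fullv Y (Q j)).
pose sp i j : 'Hom(otens_fam fullv Z G i j, XY i j) := otens_split X Y (P i) (Q j).
(* The chain isomorphism distributes the tensor product over the summands, then exchanges the middle
   factors in each. *)
pose f m : 'Hom(otens fullv Z (totmod G m), tot XY m) :=
  (totmap sp m \o otens_tot fullv Z G m)%VF.
apply: (homology_iso (f := fun m => f m.+1)) => m; last first.
  have spbij : bijective (totmap sp m.+1).
    by apply: totmap_bij => i j; apply: otens_split_bij.
  apply: (eq_bij (bij_comp spbij (otens_tot_bij fullv Z G m.+1))) => t.
  by rewrite comp_lfunE.
move=> t; rewrite !(comp_lfunE (totmap sp _)).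
rewrite [X in totmap sp _ X](@otens_tot_totd _ _ fullv Z G dh dv m.+1 t); last 2 first.
- exact: tens_dh_act_linear.
- exact: tens_dv_act_linear.
apply: totmap_totd => i j x.
  (* The scalar 1 and [omap] of the identity only bring the differential into the shape of
     [otens_split_tmap]. *)
  have -> : tens_dh (fun j => otens fullv Y (Q j)) d i j =
      1 *: tmap (omap fullv X (diff P i)) (omap fullv Y \1).
    by rewrite omap1 scale1r.
  apply: otens_split_tmap; [exact: diff_linear | exact: act_linear1 |].
  by rewrite scale1r.
have -> : tens_dv (fun i => otens fullv X (P i)) e i j =
    (-1) ^+ i *: tmap (omap fullv X \1) (omap fullv Y (diff Q j)).
  by rewrite omap1.
by apply: otens_split_tmap; [exact: act_linear1 | exact: diff_linear |].
Qed.
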